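(* Let $m\ge1$ and let $G_m$ be the braid Gauss diagram of a word in $\sigma_1^{\pm1},\dots,\sigma_{m-1}^{\pm1}$, representing the link $L$. Then for every integer $k\ge0$, $$P^\star_{k+1}(G_m)=\mathcal{P}_k(L),\qquad\text{where }\mathcal{P}_k(L):=z^k\frac{\partial^kP(L)}{\partial a^k}\Big|_{a=1}.$$
   Context: HOMFLY-PT polynomial: $P(L)\in\mathbb{Z}[a^{\pm1},z^{\pm1}]$ is the invariant of oriented links determined by $aP(L_+)-a^{-1}P(L_-)=zP(L_0)$ for any skein triple and $P(O_r)=\left(\frac{a-a^{-1}}{z}\right)^{r-1}$ for the $r$-component unlink $O_r$. Braid Gauss diagrams. $B_m$ is the Artin braid group with generators $\sigma_1,\dots,\sigma_{m-1}$. For a word $\beta$ in $\sigma_i^{\pm1}$, the closed braid diagram $D$ of $\beta$ is obtained by joining the top and bottom endpoints of the $m$ strands by $m$ parallel closing strands; it represents an oriented link. The Gauss diagram $G$ of $D$ has one oriented circle parametrizing each component of $D$, and for each crossing an arrow joining its two preimages, pointing from the overpassing preimage to the underpassing one, carrying the sign (local writhe) of the crossing. An arc of $G$ is a connected component of the complement in the circles of all arrow endpoints. The braid Gauss diagram $G_m$ is $G$ together with labels $a_1,\dots,a_m$, where $a_i$ is the arc of $G$ containing the preimage of the $i$-th closing strand. The writhe $w(G_m)$ is the sum of the signs of all arrows. $\star$-colored braid Gauss diagrams. For $k\ge1$, a $\star$-colored braid Gauss diagram associated with $k$ and $G_m$ is $G_m$ together with: base points $*_1,\dots,*_k$ placed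 on arcs $a_{j_1},\dots,a_{j_k}$ with $m=j_1>j_2>\dots>j_k\ge1$ (one base point per arc); and, for each remaining labeled arc $a_j$ ($j\notin\{j_1,\dots,j_k\}$), a number from $\{1,\dots,l\}$, where $l$ is the largest index such that $j<j_l$. $\mathfrak{G}^\star_{k,m}$ denotes the set of all such diagrams. Arrow diagrams. An arrow diagram is a finite collection of oriented circles with finitely many arrows joining pairs of distinct points of the circles, up to orientation-preserving diffeomorphisms of the circles; its arcs are the components of the complement of arrow endpoints. Its surface $\Sigma(A)$ is obtained by gluing an oriented disk to each circle and attaching, for each arrow, an untwisted band (1-handle) with that arrow as core, so that $\Sigma(A)$ is oriented. Each arc of $A$ lies on exactly one boundary component of $\Sigma(A)$. $A$ is multibased with $k$ boundary components if $\Sigma(A)$ has exactly $k$ boundary components and base points $*_1,\dots,*_k$ are placed on arcs lying on $k$ pairwise different boundary components; the one containing $*_i$ is the $i$-th boundary component. Traverse the boundary components in the order $i=1,\dots,k$, each starting from $*_i$ in the boundary orientation (which agrees with the circle orientation along arcs). Each band has two sides parallel to its core arrow; $A$ is ascending if for every arrow the first time the traversal runs along a side of its band it runs from the head end to the tail end. $\mathcal{A}_{n,k}$ is the set of ascending multibased arrow diagrams with $n$ arrows and $k$ boundary components ($\mathcal{A}_{n,k}=\emptyset$ for $n<0$). Pairing. Let $A$ be multibased with $k$ boundary components and $G\in\mathfrak{G}^\star_{k,m}$. A homomorphism $\phi:A\to G$ is a bijection between the circles of $A$ and those of $G$ together with orientation-preserving homeomorphisms of corresponding circles, mapping each base point $*_i$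 of $A$ to the base point $*_i$ of $G$, mapping arrows of $A$ injectively onto arrows of $G$ (tail to tail, head to head), and such that every non-based labeled arc of $G$ colored by a number $j$ is contained in the image of an arc of $A$ lying on the $j$-th boundary component. Homomorphisms are determined by their image set of arrows. The sign $\varepsilon(\phi)$ is the product of signs of the arrows in the image. $\langle A,G\rangle:=\sum_\phi\varepsilon(\phi)$, and $\langle A,G\rangle=0$ if $A$ and $G$ have different numbers of circles. Invariants. For $j,k\ge1$: $f_j^{(k)}(G_m):=\frac{d^{k-1}}{da^{k-1}}\left(a^{-m-w(G_m)+1}(a^2-1)^{j-1}\right)\big|_{a=1}$. For $1\le j\le k$: $A_{n,k,j}(G_m):=\sum_{G\in\mathfrak{G}^\star_{j,m}}\sum_{A\in\mathcal{A}_{n+j-k,j}}\langle A,G\rangle$, $A_{n,k}(G_m):=\sum_{j=1}^kf_j^{(k)}(G_m)A_{n,k,j}(G_m)$, and $P^\star_k(G_m):=\sum_{n\ge0}A_{n,k}(G_m)z^n$. *)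

(* Defs.v *)
From HB Require Import structures.
From mathcomp Require Import all_boot all_order all_algebra.
Set Implicit Arguments. Unset Strict Implicit. Unset Printing Implicit Defensive.
Import Order.TTheory GRing.Theory Num.Theory.

(* A Laurent polynomial is given by a finite list of monomials              *)
(* ((i, j), c) standing for  c * a^i * z^j; two lists represent the same    *)
(* Laurent polynomial iff all their coefficients agree (eqLP).              *)
Definition LP := seq ((int * int) * int).

Definition coefLP (p : LP) (i j : int) : int :=
  (\sum_(x <- p | (x.1.1 == i) && (x.1.2 == j)) x.2)%R.

Definition eqLP (p q : LP) : Prop := forall i j, coefLP p i j = coefLP q i j.

Definition lp1 : LP := [:: ((0%R, 0%R), 1%R)].
Definition lp_add (p q : LP) : LP := p ++ q.
Definition lp_opp (p : LP) : LP := [seq (x.1, (- x.2)%R) | x <- p].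
Definition lp_shift (da dz : int) (p : LP) : LP :=
  [seq ((x.1.1 + da, x.1.2 + dz)%R, x.2) | x <- p].
Definition lp_mul (p q : LP) : LP :=
  [seq ((x.1.1 + y.1.1, x.1.2 + y.1.2)%R, (x.2 * y.2)%R) | x <- p, y <- q].
Definition lp_pow (p : LP) (n : nat) : LP := iter n (lp_mul p) lp1.

(* falling factorial e (e-1) ... (e-d+1) = d^d/da^d (a^e) at a = 1 *)
Definition ffz (e : int) (d : nat) : int := (\prod_(i < d) (e - (i : nat)%:Z))%R.

(* derA d p n = coefficient of z^n in  (d^d p / da^d)|_{a=1} *)
Definition derA (d : nat) (p : LP) (n : int) : int :=
  (\sum_(x <- p | x.1.2 == n) x.2 * ffz x.1.1 d)%R.

(* Braid words.  A letter (i, true) is sigma_i, (i, false) is sigma_i^{-1}; *)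
(* i is the (1-based) generator index, 1 <= i <= m-1.                       *)
Definition letter := (nat * bool)%type.
Definition wf_word (m : nat) (w : seq letter) : bool :=
  all (fun c => (0 < c.1) && (c.1 < m)) w.

(* HOMFLY-PT polynomial of closed braids, characterised by: invariance      *)
(* under the braid group relations and the Markov moves (so it is a link    *)
(* invariant of the closure), the skein relation                            *)
(*   a P(L+) - a^{-1} P(L-) = z P(L0)                                       *)
(* (sigma_i is a positive crossing), and the values on unlinks.             *)
(* P m w is the value on the closure of the word w viewed in B_m.           *)
Definition is_homfly (P : nat -> seq letter -> LP) : Prop :=
  [/\
      (forall m u v i s, wf_word m (u ++ v) -> 0 < i < m ->
         eqLP (P m (u ++ (i, s) :: (i, ~~ s) :: v)) (P m (u ++ v))),
      (forall m u v i j s s', wf_word m (u ++ v) -> 0 < i -> i.+1 < j -> j < m ->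
         eqLP (P m (u ++ (i, s) :: (j, s') :: v)) (P m (u ++ (j, s') :: (i, s) :: v))),
      (forall m u v i, wf_word m (u ++ v) -> 0 < i -> i.+1 < m ->
         eqLP (P m (u ++ [:: (i, true); (i.+1, true); (i, true)] ++ v))
              (P m (u ++ [:: (i.+1, true); (i, true); (i.+1, true)] ++ v))),
      (forall m u v, wf_word m (u ++ v) -> eqLP (P m (u ++ v)) (P m (v ++ u))) &
      (forall m u s, 0 < m -> wf_word m u -> eqLP (P m.+1 (rcons u (m, s))) (P m u))]
  /\ [/\
      (forall m u v i, wf_word m (u ++ v) -> 0 < i < m ->
         eqLP (lp_add (lp_shift 1 0 (P m (u ++ (i, true) :: v)))
                      (lp_opp (lp_shift (-1) 0 (P m (u ++ (i, false) :: v)))))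
              (lp_shift 0 1 (P m (u ++ v)))),
      eqLP (P 1%N [::]) lp1 &
      (forall r, 0 < r -> eqLP (lp_shift 0 1 (P r.+1 [::]))
                               (lp_add (lp_shift 1 0 (P r [::]))
                                       (lp_opp (lp_shift (-1) 0 (P r [::])))))].

(* Conventions: strand positions 0..m-1 (position p is the (p+1)-th strand  *)
(* from the left); strands are oriented upwards and the word is read from   *)
(* bottom to top; sigma_i (positive crossing) exchanges positions i-1 and i *)
(* with the strand coming from the left position passing over; for         *)
(* sigma_i^{-1} the strand coming from the right position passes over.      *)
(* The closing strand at position q carries the label a_{q+1}.             *)
(* Points of the Gauss diagram are coded by natural numbers:                *)
(*   2t + 1 = head (underpass preimage) of the arrow of crossing t,         *)
(*   2t     = tail (overpass preimage) of the arrow of crossing t,          *)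
(*   2L + q = (a point of) the closing strand at position q,  L = size w.   *)
(* gnext w x is the next point along the oriented circle of G.             *)
Section Gauss.
Variable w : seq letter.

Definition crossing (t : nat) : letter := nth (0%N, true) w t.
Definition step (c : letter) (p : nat) : nat :=
  if p == c.1.-1 then c.1 else if p == c.1 then c.1.-1 else p.
Definition involved (c : letter) (q : nat) : bool := (q == c.1.-1) || (q == c.1).
Definition is_head_at (c : letter) (q : nat) : bool :=
  if c.2 then q == c.1 else q == c.1.-1.

Definition pt_end (t : nat) (h : bool) : nat := (2 * t + h)%N.
Definition pt_mark (q : nat) : nat := (2 * size w + q)%N.

(* follow a strand at position q from level t (just before crossing t) *)
Fixpoint walk (fuel q t : nat) : nat :=
  match fuel with
  | 0 => pt_mark q
  | fuel'.+1 =>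
      let c := crossing t in
      if involved c q then pt_end t (is_head_at c q) else walk fuel' (step c q) t.+1
  end.

Definition gnext (x : nat) : nat :=
  if x < 2 * size w then
    let t := x./2 in let c := crossing t in
    let q := if is_head_at c c.1.-1 == odd x then c.1.-1 else c.1 in
    walk (size w - t.+1) (step c q) t.+1
  else walk (size w) (x - 2 * size w) 0.

Definition partner (x : nat) : nat := if odd x then x.-1 else x.+1.

Variable m : nat.
Definition npts : nat := (2 * size w + m)%N.

(* The sub-arrow-diagram G_S of G on a set S of arrows (crossings).  Its    *)
(* surface boundary is traversed by bnext: along an arc, and on reaching an *)
(* endpoint x of an arrow of S, along a side of its band (from x to its     *)
(* partner), then on along the circle.  The cycles of bnext on the points   *)
(* of G are exactly the boundary components of Sigma(G_S).                  *)
Variable S : {set 'I_(size w)}.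

Definition inS (x : nat) : bool := (x < 2 * size w) && [exists t in S, val t == x./2].
Definition bnext (x : nat) : nat := if inS x then gnext (partner x) else gnext x.

Definition conn (x y : nat) : bool :=
  has (fun i => iter i bnext x == y) (iota 0 npts).
Definition bindex (x y : nat) : nat :=
  find (fun i => iter i bnext x == y) (iota 0 npts).
Definition nbound : nat :=
  count (fun x => all (fun y => conn x y ==> (x <= y)) (iota 0 npts)) (iota 0 npts).

(* bl = [:: q_1; ...; q_k]: base point *_l on the arc a_{q_l + 1} *)
Variable bl : seq nat.

Definition multibased : bool :=
  (nbound == size bl) &&
  [forall l1 : 'I_(size bl), forall l2 : 'I_(size bl),
      (l1 != l2) ==> ~~ conn (pt_mark (nth 0%N bl l1)) (pt_mark (nth 0%N bl l2))].

(* the time at which the traversal (components 1, ..., k in order, each    *)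
(* started at its base point) leaves the point x                           *)
Definition btime (x : nat) : nat :=
  let l := find (fun q => conn (pt_mark q) x) bl in
  (l * npts + bindex (pt_mark (nth 0%N bl l)) x)%N.

(* for every arrow of S, its band is first run along from the head end *)
Definition ascending : bool :=
  [forall t in S, btime (pt_end t true) < btime (pt_end t false)].

End Gauss.

Definition writhe (w : seq letter) : int :=
  (\sum_(c <- w) (if c.2 then 1 else -1))%R.

Definition arrow_sign (w : seq letter) (S : {set 'I_(size w)}) : int :=
  (\prod_(t in S) (if (crossing w t).2 then 1 else -1))%R.

Definition base_list m (B : {set 'I_m}) : seq nat := sort geq [seq val i | i <- enum B].
(* l(q) = largest index l with q < j_l *)
Definition lmax (bl : seq nat) (q : nat) : nat := count (fun b => q < b) bl.

Definition col_ok m j (B : {set 'I_m}) (col : {ffun 'I_m -> 'I_j.+1}) : bool :=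
  [forall q : 'I_m, if q \in B then val (col q) == 0%N
                    else (0 < col q) && (col q <= lmax (base_list B) q)].

Definition colored (w : seq letter) m (S : {set 'I_(size w)}) (B : {set 'I_m})
    j (col : {ffun 'I_m -> 'I_j.+1}) : bool :=
  [forall q : 'I_m, (q \notin B) ==>
     @conn w m S (pt_mark w (nth 0%N (base_list B) (col q).-1)) (pt_mark w q)].

Definition A_nkj (w : seq letter) (m n k j : nat) : int :=
  (\sum_(B : {set 'I_m} | [exists i in B, val i == m.-1] && (#|B| == j))
    \sum_(col : {ffun 'I_m -> 'I_j.+1} | @col_ok m j B col)
      \sum_(S : {set 'I_(size w)} |
              [&& #|S| + k == n + j,
                  @multibased w m S (base_list B),
                  @ascending w m S (base_list B) & @colored w m S B j col])
        @arrow_sign w S)%R.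

Definition f_jk (w : seq letter) (m k j : nat) : int :=
  derA k.-1 (lp_mul [:: ((1 - Posz m - writhe w)%R, 0%R, 1%R)]
                    (lp_pow [:: ((Posz 2, 0%R), 1%R); ((0%R, 0%R), (-1)%R)] j.-1)) 0.

Definition A_nk (w : seq letter) (m n k : nat) : int :=
  (\sum_(1 <= j < k.+1) f_jk w m k j * A_nkj w m n k j)%R.

Definition Pstar_coef (w : seq letter) (m k : nat) (n : int) : int :=
  match n with Posz n' => A_nk w m n' k | Negz _ => 0%R end.

(* Main.v *)
Require Import Defs.
From HB Require Import structures.
From mathcomp Require Import all_boot all_order all_algebra.
From mathcomp Require Import zify ring.
Import Order.TTheory GRing.Theory Num.Theory.

Set Implicit Arguments. Unset Strict Implicit. Unset Printing Implicit Defensive.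

(* For a fixed set S of smoothed crossings, at most one choice of base points
   and colours contributes: the base points must be the rightmost closing strands
   of the boundary components.  Hence P^star is Jaeger's state sum
     a^(1-m-w) * sum over S of sign(S) z^|S| ((a^2-1)/z)^(r(S)-1)
   over the states whose traversal, started at the rightmost strand of each
   component from right to left, first reaches every
   smoothed crossing at its underpass.
   To see that P(L) is the same sum, follow the rightmost strand of the braid
   upwards and keep it above everything met so far, as the braid
   sigma_(m-1)^-1 .. sigma_(s+1)^-1: a crossing it passes over, or that does not
   involve it, moves below it by braid relations, and one it passes under is
   resolved by the skein relation.  At the top, conjugation and a Markov move (or
   the splitting of a free strand) leave a braid on m - 1 strands, in which the
   traversal simply goes on. *)

(** * Coefficients and braid words *)

(** Removing a strand renumbers positions, so the induction follows strand labels: a smoothing is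
    recorded as a pair of labels, which survives conjugation and Markov moves, and being first
    reached at the underpass becomes a comparison of two places in the list [travel]. That list
    consumes the closed state strand by strand, as the skein induction does, whereas the definition
    of $P^\star$ orders Gauss points by boundary component and number of steps. The function [key]
    mediates between the two: both orders are the order of the keys of strands. Replacing Gauss
    points by strands loses nothing, because the two ends of a smoothed crossing always lie on
    different strands of the state, so ties never occur. The two sums still differ in range:
    $P^\star_{k+1}$ stops at $k+1$ base points and has no negative powers of $z$. Both gaps are
    closed by the zero of order $r$ of $(a^2-1)^r$ at $a=1$: only states with $r\le k$ contribute to
    a $k$-th derivative. *)

Section LaurentCoefficients.
Local Open Scope ring_scope.

Lemma coefLP_add p q i j : coefLP (lp_add p q) i j = coefLP p i j + coefLP q i j.
Proof. by rewrite /coefLP /lp_add big_cat. Qed.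

Lemma coefLP_opp p i j : coefLP (lp_opp p) i j = - coefLP p i j.
Proof. by rewrite /coefLP /lp_opp big_map /= sumrN. Qed.

Lemma coefLP_shift da dz p i j :
  coefLP (lp_shift da dz p) i j = coefLP p (i - da) (j - dz).
Proof.
rewrite /coefLP /lp_shift big_map /=; apply: eq_bigl => x /=.
by congr (_ && _); apply/eqP/eqP; lia.
Qed.

End LaurentCoefficients.

Lemma writhe_cat u v : writhe (u ++ v) = (writhe u + writhe v)%R.
Proof. by rewrite /writhe big_cat. Qed.

Lemma writhe_nil : writhe [::] = 0%R.
Proof. by rewrite /writhe big_nil. Qed.

Lemma writhe_cons c v : writhe (c :: v) = ((if c.2 then 1 else -1) + writhe v)%R.
Proof. by rewrite /writhe big_cons. Qed.

Lemma wf_cat m u v : wf_word m (u ++ v) = wf_word m u && wf_word m v.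
Proof. by rewrite /wf_word all_cat. Qed.

Lemma wf_widen m n u : m <= n -> wf_word m u -> wf_word n u.
Proof. by move=> le; apply: sub_all => c /=; lia. Qed.

(* The word in which the rightmost strand crosses over to position [s]. *)
Definition overpass m s : seq letter :=
  [seq (i, false) | i <- rev (iota s.+1 (m.-1 - s))].

Lemma overpass_nil m : overpass m m.-1 = [::].
Proof. by rewrite /overpass subnn. Qed.

Lemma overpass_left m s : 0 < s < m ->
  overpass m s.-1 = rcons (overpass m s) (s, false).
Proof.
move=> /andP[s0 sm]; rewrite /overpass prednK //.
have -> : m.-1 - s.-1 = (m.-1 - s).+1 by lia.
by rewrite /= rev_cons map_rcons.
Qed.

(** Isolates the only letter that involves the last strand; conjugation brings it to the end of the
    word, where a Markov move removes it. *)
Lemma overpass_widen m s : s < m -> overpass m.+1 s = (m, false) :: overpass m s.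
Proof.
move=> sm; rewrite /overpass /=.
have -> : m - s = m.-1 - s + 1 by lia.
rewrite iotaD rev_cat map_cat /= addSnnS; congr ((_, _) :: _); lia.
Qed.

Lemma wf_overpass m s : wf_word m (overpass m s).
Proof.
apply/allP => c /mapP[i]; rewrite mem_rev mem_iota => h -> /=; lia.
Qed.

Section Homfly.
Variable P : nat -> seq letter -> LP.
Hypothesis HP : is_homfly P.

Section WordEquivalence.
Variable m : nat.

(** Stands in for equality in the braid group: words that [P] cannot tell apart in any context. This
    makes it a congruence ([weq_ctx]) without constructing the group. *)
Definition weq u v := forall p q, wf_word m p -> wf_word m q ->
  eqLP (P m (p ++ u ++ q)) (P m (p ++ v ++ q)).

Lemma weq_sym u v : weq u v -> weq v u.
Proof. by move=> h p q hp hq i j; rewrite h. Qed.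
Lemma weq_trans v u w : weq u v -> weq v w -> weq u w.
Proof. by move=> h1 h2 p q hp hq i j; rewrite h1 ?h2. Qed.
Lemma weq_ctx p q u v : weq u v -> wf_word m p -> wf_word m q ->
  weq (p ++ u ++ q) (p ++ v ++ q).
Proof.
move=> h hp hq p' q' hp' hq' i j.
have := h (p' ++ p) (q ++ q'); rewrite !wf_cat hp hq hp' hq' -!catA; exact.
Qed.

Lemma weq_cancel i s : 0 < i < m -> weq [:: (i, s); (i, ~~ s)] [::].
Proof.
by case: HP => -[h _ _ _ _] _ hi p q hp hq; apply: h; rewrite ?wf_cat ?hp.
Qed.

Lemma weq_far i j s s' : 0 < i -> i.+1 < j -> j < m ->
  weq [:: (i, s); (j, s')] [:: (j, s'); (i, s)].
Proof.
by case: HP => -[_ h _ _ _] _ hi hj hm p q hp hq; apply: h; rewrite ?wf_cat ?hp.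
Qed.

Lemma weq_braid i : 0 < i -> i.+1 < m ->
  weq [:: (i, true); (i.+1, true); (i, true)]
      [:: (i.+1, true); (i, true); (i.+1, true)].
Proof.
by case: HP => -[_ _ h _ _] _ hi hm p q hp hq; apply: h; rewrite ?wf_cat ?hp.
Qed.

Lemma weq_braid_neg i e : 0 < i -> i.+1 < m ->
  weq [:: (i.+1, false); (i, false); (i.+1, e)]
      [:: (i, e); (i.+1, false); (i, false)].
Proof.
move=> i0 im.
have hb : 0 < i.+1 < m by rewrite im.
have ha : 0 < i < m by rewrite i0 ltnW.
pose a := (i, true); pose b := (i.+1, true).
pose a' := (i, false); pose b' := (i.+1, false).
case: e.
- apply: (@weq_trans [:: b'; a'; b; a; a']).
    by apply: weq_sym; apply: (@weq_ctx [:: b'; a'; b] [::] _ [::] (weq_cancel true ha)); rewrite /wf_word /= ?i0 ?im ?(ltnW im).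
  apply: (@weq_trans [:: b'; a'; b; a; b; b'; a']).
    by apply: weq_sym; apply: (@weq_ctx [:: b'; a'; b; a] [:: a'] _ [::] (weq_cancel true hb)); rewrite /wf_word /= ?i0 ?im ?(ltnW im).
  apply: (@weq_trans [:: b'; a'; a; b; a; b'; a']).
    by apply: (@weq_ctx [:: b'; a'] [:: b'; a'] _ _ (weq_sym (weq_braid i0 im))); rewrite /wf_word /= ?i0 ?im ?(ltnW im).
  apply: (@weq_trans [:: b'; b; a; b'; a']).
    by apply: (@weq_ctx [:: b'] [:: b; a; b'; a'] _ _ (weq_cancel false ha)); rewrite /wf_word /= ?i0 ?im ?(ltnW im).
  by apply: (@weq_ctx [::] [:: a; b'; a'] _ _ (weq_cancel false hb)); rewrite /wf_word /= ?i0 ?im ?(ltnW im).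
(* Here the claim is the inverse braid relation. The trivial word [a' b' a' a b a] is inserted in
   front; rewriting its second half as [b a b] cancels the original word. *)
- apply: (@weq_trans [:: a'; a; b'; a'; b']).
    by apply: weq_sym; apply: (@weq_ctx [::] [:: b'; a'; b'] _ [::] (weq_cancel false ha)); rewrite /wf_word /= ?i0 ?im ?(ltnW im).
  apply: (@weq_trans [:: a'; b'; b; a; b'; a'; b']).
    by apply: weq_sym; apply: (@weq_ctx [:: a'] [:: a; b'; a'; b'] _ [::] (weq_cancel false hb)); rewrite /wf_word /= ?i0 ?im ?(ltnW im).
  apply: (@weq_trans [:: a'; b'; a'; a; b; a; b'; a'; b']).
    by apply: weq_sym; apply: (@weq_ctx [:: a'; b'] [:: b; a; b'; a'; b'] _ [::] (weq_cancel false ha)); rewrite /wf_word /= ?i0 ?im ?(ltnW im).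
  apply: (@weq_trans [:: a'; b'; a'; b; a; b; b'; a'; b']).
    by apply: (@weq_ctx [:: a'; b'; a'] [:: b'; a'; b'] _ _ (weq_braid i0 im)); rewrite /wf_word /= ?i0 ?im ?(ltnW im).
  apply: (@weq_trans [:: a'; b'; a'; b; a; a'; b']).
    by apply: (@weq_ctx [:: a'; b'; a'; b; a] [:: a'; b'] _ _ (weq_cancel true hb)); rewrite /wf_word /= ?i0 ?im ?(ltnW im).
  apply: (@weq_trans [:: a'; b'; a'; b; b']).
    by apply: (@weq_ctx [:: a'; b'; a'; b] [:: b'] _ _ (weq_cancel true ha)); rewrite /wf_word /= ?i0 ?im ?(ltnW im).
  by apply: (@weq_ctx [:: a'; b'; a'] [::] _ _ (weq_cancel true hb)); rewrite /wf_word /= ?i0 ?im ?(ltnW im).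
Qed.

Lemma weq_comm_seq (l : seq letter) c : wf_word m l -> wf_word m [:: c] ->
  (forall x, x \in l -> weq [:: x; c] [:: c; x]) ->
  weq (l ++ [:: c]) (c :: l).
Proof.
elim: l => [|x l IH] // /andP[hx hl] hc h.
have hl' : weq (l ++ [:: c]) (c :: l).
  by apply: IH => // y hy; apply: h; rewrite inE hy orbT.
apply: (@weq_trans (x :: c :: l)).
  have := @weq_ctx [:: x] [::] _ _ hl'.
  by rewrite !cats0 /=; apply => //; rewrite /wf_word /= hx.
by apply: (@weq_ctx [::] l _ _ (h x _)); rewrite // mem_head.
Qed.

Lemma weq_overpass_far s i e : 0 < i < s -> s < m ->
  weq (overpass m s ++ [:: (i, e)]) ((i, e) :: overpass m s).
Proof.
move=> hi sm; apply: weq_comm_seq; first exact: wf_overpass.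
  by rewrite /wf_word /=; lia.
move=> x /mapP[j]; rewrite mem_rev mem_iota => hj ->.
by apply/weq_sym/weq_far; lia.
Qed.

(** Below the overpass the rightmost strand has not yet crossed over to the left, so the same
    crossing sits one position further left. Only the letters [i] and [i.-1] of the overpass fail to
    commute with what is moved past them, and they are treated by [weq_braid_neg]. *)
Lemma weq_overpass_braid s i e : s.+1 < i -> i < m ->
  weq (overpass m s ++ [:: (i, e)]) ((i.-1, e) :: overpass m s).
Proof.
move=> hi im.
pose lo := [seq (k, false) | k <- rev (iota s.+1 (i.-2 - s))] : seq letter.
pose hi' := [seq (k, false) | k <- rev (iota i.+1 (m.-1 - i))] : seq letter.
have -> : overpass m s = hi' ++ [:: (i, false); (i.-1, false)] ++ lo.
  rewrite /overpass /hi' /lo.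
  have -> : m.-1 - s = (i.-2 - s) + (2 + (m.-1 - i)) by lia.
  rewrite !iotaD !rev_cat !map_cat -catA.
  have -> : s.+1 + (i.-2 - s) = i.-1 by lia.
  have -> : i.-1 + 2 = i.+1 by lia.
  by rewrite /rev /= (ltn_predK hi).
have whi : wf_word m hi'.
  by apply/allP => c /mapP[j]; rewrite mem_rev mem_iota => h -> /=; lia.
have wlo : wf_word m lo.
  by apply/allP => c /mapP[j]; rewrite mem_rev mem_iota => h -> /=; lia.
have wi d : wf_word m [:: (i, d)] by rewrite /wf_word /=; lia.
have wi1 d : wf_word m [:: (i.-1, d)] by rewrite /wf_word /=; lia.
have hlo : weq (lo ++ [:: (i, e)]) ((i, e) :: lo).
  apply: weq_comm_seq => // x /mapP[j]; rewrite mem_rev mem_iota => hj ->.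
  by apply: weq_far; lia.
have hhi : weq (hi' ++ [:: (i.-1, e)]) ((i.-1, e) :: hi').
  apply: weq_comm_seq => // x /mapP[j]; rewrite mem_rev mem_iota => hj ->.
  by apply/weq_sym/weq_far; lia.
have hmid : weq [:: (i, false); (i.-1, false); (i, e)]
                [:: (i.-1, e); (i, false); (i.-1, false)].
  by case: (i) hi im => // k hk km; apply: weq_braid_neg; lia.
apply: (@weq_trans (hi' ++ [:: (i, false); (i.-1, false); (i, e)] ++ lo)).
  have := @weq_ctx (hi' ++ [:: (i, false); (i.-1, false)]) [::] _ _ hlo.
  rewrite !cats0 !wf_cat whi -!catA /=; apply=> //.
  by move: (wi false) (wi1 false); rewrite /wf_word /= !andbT => -> ->.
apply: (@weq_trans (hi' ++ [:: (i.-1, e); (i, false); (i.-1, false)] ++ lo)).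
  exact: weq_ctx.
have := @weq_ctx [::] ([:: (i, false); (i.-1, false)] ++ lo) _ _ hhi.
rewrite -!catA /= -/([:: _] ++ lo); apply=> //.
by move: (wi false) (wi1 false) wlo; rewrite /wf_word /= !andbT => -> ->.
Qed.

End WordEquivalence.

Section NormalizedCoefficients.
Local Open Scope ring_scope.

(* Coefficient of [a^x z^y] in [a^(m + writhe w - 1) * P m w]: the skein
   relation then loses its powers of [a]. *)
Definition ncoef m w (x y : int) : int :=
  coefLP (P m w) (x + 1 - m%:Z - writhe w) y.

Lemma ncoef_weq m p q u v x y : weq m u v -> writhe u = writhe v ->
  wf_word m p -> wf_word m q ->
  ncoef m (p ++ u ++ q) x y = ncoef m (p ++ v ++ q) x y.
Proof. by move=> h hw hp hq; rewrite /ncoef !writhe_cat hw (h p q hp hq). Qed.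

Lemma ncoef_skein m u v i x y : wf_word m (u ++ v) -> (0 < i < m)%N ->
  ncoef m (u ++ (i, true) :: v) x y - ncoef m (u ++ (i, false) :: v) x y =
  ncoef m (u ++ v) x (y - 1).
Proof.
case: HP => _ [h _ _] hw hi.
have := h m u v i hw hi (x + 1 - m%:Z - writhe (u ++ v)) y.
rewrite coefLP_add coefLP_opp !coefLP_shift /ncoef !writhe_cat !writhe_cons /=.
rewrite !subr0 => <-; congr (_ - _); congr coefLP; lia.
Qed.

Lemma ncoef_cyc m u v x y : wf_word m (u ++ v) ->
  ncoef m (u ++ v) x y = ncoef m (v ++ u) x y.
Proof.
case: HP => -[_ _ _ h _] _ hw.
by rewrite /ncoef h // !writhe_cat; congr coefLP; lia.
Qed.

(** The new strand and the new negative crossing cancel in the exponent [m + writhe w - 1], so no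
    power of $a$ appears. *)
Lemma ncoef_markov m u x y : (0 < m)%N -> wf_word m u ->
  ncoef m.+1 (rcons u (m, false)) x y = ncoef m u x y.
Proof.
case: HP => -[_ _ _ _ h] _ m0 hw.
rewrite /ncoef h // -cats1 writhe_cat writhe_cons /=; congr coefLP.
by rewrite /writhe big_nil; lia.
Qed.

(** Origin of the factor $(a^2-1)/z$ of a free strand: in the skein relation at an added last
    crossing, both signs reduce to [u] by Markov moves, and the positive one keeps an $a^2$ from the
    normalization. *)
Lemma ncoef_split m u x y : (0 < m)%N -> wf_word m u ->
  ncoef m.+1 u x (y - 1) = ncoef m u (x - 2) y - ncoef m u x y.
Proof.
move=> m0 hw; have hw' := wf_widen (leqnSn m) hw.
case: HP => -[_ _ _ _ hm] [h _ _].
have := h m.+1 u [::] m; rewrite cats0 m0 ltnSn => /(_ hw' isT).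
move=> /(_ (x + 1 - (m.+1)%:Z - writhe u) y).
rewrite coefLP_add coefLP_opp !coefLP_shift /ncoef !cats1 !hm // !subr0 => <-.
by congr (_ - _); congr coefLP; lia.
Qed.

End NormalizedCoefficients.
End Homfly.

(** * Strand labels of a state *)

Definition insert_at (T : Type) s (x : T) l := take s l ++ x :: drop s l.
Definition delete_at (T : Type) s (l : seq T) := take s l ++ drop s.+1 l.

Section SeqEdit.
Variable T : Type.
Implicit Types (x y : T) (l : seq T).

Lemma size_insert_at s x l : size (insert_at s x l) = (size l).+1.
Proof. by rewrite size_cat /= addnS -size_cat cat_take_drop. Qed.

Lemma nth_insert_at x0 s x l p : s <= size l ->
  nth x0 (insert_at s x l) p =
  if p < s then nth x0 l p else if p == s then x else nth x0 l p.-1.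
Proof.
move=> hs; rewrite nth_cat size_takel //; case: ltnP => hp.
  by rewrite nth_take.
case: (eqVneq p s) => [->|hne]; first by rewrite subnn.
have -> : p - s = (p.-1 - s).+1 by lia.
by rewrite /= nth_drop; congr nth; lia.
Qed.

Lemma insert_at_size x l : insert_at (size l) x l = rcons l x.
Proof. by rewrite /insert_at take_size drop_size cats1. Qed.

Lemma delete_insert_at s x l : s <= size l -> delete_at s (insert_at s x l) = l.
Proof.
move=> hs; rewrite /delete_at /insert_at take_size_cat ?size_takel //.
by rewrite drop_cat size_takel // ltnNge leqnSn /= subSnn /= drop0 cat_take_drop.
Qed.

Lemma insert_delete_at x0 s l : s < size l ->
  insert_at s (nth x0 l s) (delete_at s l) = l.
Proof.
move=> hs; rewrite /insert_at /delete_at take_size_cat ?size_takel ?(ltnW hs) //.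
by rewrite drop_size_cat ?size_takel ?(ltnW hs) // -drop_nth // cat_take_drop.
Qed.

Lemma size_delete_at s l : s < size l -> size (delete_at s l) = (size l).-1.
Proof.
case: l => // a l hs; rewrite -[in RHS](insert_delete_at a hs) size_insert_at.
by [].
Qed.

End SeqEdit.

Section SeqEditEq.
Variable T : eqType.
Implicit Types (x y : T) (l : seq T).

Lemma index_insert_at s x l : s <= size l -> x \notin l ->
  index x (insert_at s x l) = s.
Proof.
move=> hs hx; rewrite index_cat /= eqxx addn0 size_takel // ifN //.
by apply: contra hx => /mem_take.
Qed.

Lemma perm_insert_at s x l : perm_eq (insert_at s x l) (x :: l).
Proof. by rewrite /insert_at -cat1s perm_catCA /= cat_take_drop. Qed.

Lemma uniq_insert_at s x l : uniq (insert_at s x l) = (x \notin l) && uniq l.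
Proof.
by rewrite (perm_uniq (perm_insert_at s x l)).
Qed.

End SeqEditEq.

Section StrandLabels.

Definition over_pos (c : letter) := if c.2 then c.1.-1 else c.1.
Definition under_pos (c : letter) := if c.2 then c.1 else c.1.-1.

(* A state of a braid word keeps some crossings and smooths those flagged by a
   bit sequence.  [run] carries strand labels from bottom to top of the state,
   and [meets] lists the pairs (under label, over label) at the smoothings. *)
Definition cross (c : letter) (l : seq nat) :=
  mkseq (fun p => nth 0 l (step c p)) (size l).

Fixpoint run (l : seq nat) (w : seq letter) (b : bitseq) : seq nat :=
  match w, b with
  | c :: w', f :: b' => run (if f then l else cross c l) w' b'
  | _, _ => l
  end.

Fixpoint meets (l : seq nat) (w : seq letter) (b : bitseq) : seq (nat * nat) :=
  match w, b with
  | c :: w', f :: b' =>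
      if f then (nth 0 l (under_pos c), nth 0 l (over_pos c)) :: meets l w' b'
      else meets (cross c l) w' b'
  | _, _ => [::]
  end.

Lemma size_cross c l : size (cross c l) = size l.
Proof. by rewrite size_mkseq. Qed.

Lemma size_run l w b : size (run l w b) = size l.
Proof. by elim: w l b => [|c w IH] l [|[] b] //=; rewrite IH ?size_cross. Qed.

Lemma step_lt m c p : 0 < c.1 < m -> p < m -> step c p < m.
Proof. by rewrite /step; case: ifP; [|case: ifP]; lia. Qed.

Lemma cross_sub c l : 0 < c.1 < size l -> {subset cross c l <= l}.
Proof.
move=> hc x /mapP[p]; rewrite mem_iota add0n => hp ->.
by rewrite mem_nth // step_lt.
Qed.

Lemma run_sub l w b : wf_word (size l) w -> {subset run l w b <= l}.
Proof.
elim: w l b => [|c w IH] l b hw x //; case: b => [|[] b] //=.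
  by case/andP: hw => _ hw; exact: IH.
case/andP: hw => hc hw; rewrite -(size_cross c) in hw.
by move=> /(IH _ _ hw) /(cross_sub hc).
Qed.

Lemma meets_sub l w b p : wf_word (size l) w -> p \in meets l w b ->
  (p.1 \in l) && (p.2 \in l).
Proof.
elim: w l b => [|c w IH] l b hw //; case: b => [|f b] //=.
case/andP: hw => hc hw; case: f.
  rewrite inE => /orP[/eqP->|]; last exact: IH.
  by case: c hc => i [] /= hc; rewrite !mem_nth // /under_pos /over_pos /=; lia.
rewrite -(size_cross c) in hw => hp; have /andP[h1 h2] := IH _ _ hw hp.
by rewrite !(cross_sub hc).
Qed.

Lemma run_rcons l w b c f : size w = size b ->
  run l (rcons w c) (rcons b f) =
  if f then run l w b else cross c (run l w b).
Proof. by elim: w l b => [|d w IH] l [|g b] //= [hs]; rewrite IH. Qed.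

Lemma meets_rcons l w b c f : size w = size b ->
  meets l (rcons w c) (rcons b f) = meets l w b ++
  (if f then [:: (nth 0 (run l w b) (under_pos c), nth 0 (run l w b) (over_pos c))]
   else [::]).
Proof.
by elim: w l b => [|d w IH] l [|g b] //= [hs]; case: g; rewrite IH.
Qed.

(** With the three lemmas that follow, this gives the effect on labels of the four positions that a
    letter can have relative to the end [s] of the overpass; they mirror the relations between
    words. *)
Lemma cross_insert_far c s x l : 0 < c.1 < s -> s <= size l ->
  cross c (insert_at s x l) = insert_at s x (cross c l).
Proof.
move=> hc hs; apply: (@eq_from_nth _ 0).
  by rewrite size_cross !size_insert_at size_cross.
move=> p; rewrite size_cross size_insert_at => hp.
rewrite nth_mkseq ?size_insert_at // !nth_insert_at ?size_cross //.
have hst q : q < s -> step c q < s by apply: step_lt.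
case: (ltnP p s) => ps; first by rewrite hst // nth_mkseq //; lia.
have -> : step c p = p by rewrite /step !ifN //; lia.
rewrite ltnNge ps /=; case: eqP => // ne; rewrite nth_mkseq; last by lia.
by have -> : step c p.-1 = p.-1 by rewrite /step !ifN //; lia.
Qed.

Lemma cross_insert_shift i e s x l : s.+1 < i -> i <= size l ->
  cross (i, e) (insert_at s x l) = insert_at s x (cross (i.-1, e) l).
Proof.
move=> hi hs; apply: (@eq_from_nth _ 0).
  by rewrite size_cross !size_insert_at size_cross.
move=> p; rewrite size_cross size_insert_at => hp.
have sl : s <= size l by lia.
rewrite nth_mkseq ?size_insert_at // !nth_insert_at ?size_cross //.
case: (ltnP p s) => ps.
  have -> : step (i, e) p = p by rewrite /step /= !ifN //; lia.
  rewrite ps nth_mkseq; last by lia.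
  by have -> : step (i.-1, e) p = p by rewrite /step /= !ifN //; lia.
case: (eqVneq p s) => [->|ne].
  have -> : step (i, e) s = s by rewrite /step /= !ifN //; lia.
  by rewrite ltnn eqxx.
rewrite nth_mkseq; last by lia.
have -> : step (i, e) p = (step (i.-1, e) p.-1).+1.
  rewrite /step /=.
  by do !case: ifP => ?; lia.
have h : s <= step (i.-1, e) p.-1.
  by rewrite /step /=; do !case: ifP => ?; lia.
by rewrite ltnNge (leqW h) /= gtn_eqF.
Qed.

Lemma cross_insert_left e s x l : 0 < s <= size l ->
  cross (s, e) (insert_at s x l) = insert_at s.-1 x l.
Proof.
move=> /andP[s0 hs]; apply: (@eq_from_nth _ 0).
  by rewrite size_cross !size_insert_at.
move=> p; rewrite size_cross size_insert_at => hp.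
rewrite nth_mkseq ?size_insert_at // !nth_insert_at //; last by lia.
rewrite /step /=; case: (eqVneq p s.-1) => [->|n1]; first by rewrite ltnn eqxx ltnn.
case: (eqVneq p s) => [->|n2].
  have -> : s.-1 < s by lia.
  by have -> : s < s.-1 = false by lia.
by case: ltnP => h; case: ltnP => h' //; do ?case: ifP => ? //; lia.
Qed.

Lemma cross_insert_right e s x l : s < size l ->
  cross (s.+1, e) (insert_at s x l) = insert_at s.+1 x l.
Proof.
move=> hs; apply: (@eq_from_nth _ 0).
  by rewrite size_cross !size_insert_at.
move=> p; rewrite size_cross size_insert_at => hp.
rewrite nth_mkseq ?size_insert_at // !nth_insert_at // ?(ltnW hs) //.
rewrite /step /=; case: (eqVneq p s) => [->|n1].
  have -> : (s.+1 < s) = false by lia.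
  have -> : (s.+1 == s) = false by lia.
  by rewrite ltnSn.
case: (eqVneq p s.+1) => [->|n2]; first by rewrite ltnn eqxx ltnn.
by case: ltnP => h; case: ltnP => h' //; do ?case: ifP => ? //; lia.
Qed.

(* The labels of the [n] strands in the order in which the closed state is
   travelled, where [l] and [l'] list them along the bottom and the top: a
   component is started at the rightmost remaining strand, and a strand already
   travelled is removed, its predecessor being continued by its successor. *)
Fixpoint travel n (l l' : seq nat) : seq nat :=
  if n is n'.+1 then
    let x := last 0 l in let p := index x l' in let r := take n' l in
    x :: travel n' (if p == n' then r else rcons (delete_at p r) (nth 0 r p))
                   (delete_at p l')
  else [::].

(* The number of components of the closed state, minus one. *)
Fixpoint extra_comps n (l l' : seq nat) : nat :=
  if n is n'.+1 then
    let x := last 0 l in let p := index x l' in let r := take n' l in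
    ((0 < n') && (p == n')) +
    extra_comps n' (if p == n' then r else rcons (delete_at p r) (nth 0 r p))
                   (delete_at p l')
  else 0.

Lemma travel_insert s x l l' : size l' = size l -> s <= size l -> x \notin l' ->
  travel (size l).+1 (rcons l x) (insert_at s x l') =
  x :: travel (size l)
    (if s == size l then l else rcons (delete_at s l) (nth 0 l s)) l'.
Proof.
move=> hl hs hx; rewrite /= last_rcons index_insert_at ?hl //.
by rewrite -cats1 take_size_cat // delete_insert_at ?hl.
Qed.

Lemma extra_comps_insert s x l l' : size l' = size l -> s <= size l -> x \notin l' ->
  extra_comps (size l).+1 (rcons l x) (insert_at s x l') =
  ((0 < size l) && (s == size l)) + extra_comps (size l)
    (if s == size l then l else rcons (delete_at s l) (nth 0 l s)) l'.
Proof.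
move=> hl hs hx; rewrite /= last_rcons index_insert_at ?hl //.
by rewrite -cats1 take_size_cat // delete_insert_at ?hl.
Qed.

Definition precede (o : seq nat) (pr : seq (nat * nat)) :=
  all (fun p => index p.1 o < index p.2 o) pr.

Lemma precede_cons x o pr :
  (forall p, p \in pr -> (p.1 != x) && (p.2 != x)) ->
  precede (x :: o) pr = precede o pr.
Proof.
move=> h; apply: eq_in_all => p /h /andP[h1 h2] /=.
by rewrite !(eq_sym x) (negbTE h1) (negbTE h2).
Qed.

Lemma precede_cat o p q : precede o (p ++ q) = precede o p && precede o q.
Proof. exact: all_cat. Qed.

End StrandLabels.

(** * The state sum computes the HOMFLY-PT polynomial *)

Section StateSum.
Local Open Scope ring_scope.

(** Recursive, so that splitting off the first letter of a braid word is a computation; the last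
    letter is split off by [bsum_rcons]. *)
Fixpoint bsum n (F : bitseq -> int) : int :=
  if n is n'.+1 then bsum n' (fun b => F (false :: b)) + bsum n' (fun b => F (true :: b))
  else F [::].

Lemma eq_bsum n F F' : (forall b, size b = n -> F b = F' b) ->
  bsum n F = bsum n F'.
Proof.
elim: n F F' => [|n IH] F F' h /=; first exact: h.
by congr (_ + _); apply: IH => b hb; apply: h; rewrite /= hb.
Qed.

Lemma bsum_eq0 n F : (forall b, size b = n -> F b = 0) -> bsum n F = 0.
Proof.
elim: n F => [|n IH] F h /=; first exact: h.
by rewrite !IH ?addr0 // => b hb; apply: h; rewrite /= hb.
Qed.

Lemma bsumD n F F' : bsum n (fun b => F b + F' b) = bsum n F + bsum n F'.
Proof. by elim: n F F' => [|n IH] F F' //=; rewrite !IH addrACA. Qed.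

Lemma bsumZ n a F : bsum n (fun b => a * F b) = a * bsum n F.
Proof. by elim: n F => [|n IH] F //=; rewrite !IH mulrDr. Qed.

Lemma bsum_rcons n F :
  bsum n.+1 F = bsum n (fun b => F (rcons b false) + F (rcons b true)).
Proof.
elim: n F => [|n IH] F //.
have -> : bsum n.+2 F =
  bsum n.+1 (fun b => F (false :: b)) + bsum n.+1 (fun b => F (true :: b)) by [].
by rewrite [X in X + _]IH [X in _ + X]IH.
Qed.

Definition a2m1 : LP := [:: ((Posz 2, 0), 1); ((0, 0), -1)].

Definition kcoef r (x : int) := coefLP (lp_pow a2m1 r) x 0.

Lemma kcoefS r x : kcoef r.+1 x = kcoef r (x - 2) - kcoef r x.
Proof.
rewrite /kcoef /lp_pow iterS -/(lp_pow _ r); move: (lp_pow a2m1 r) => p.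
rewrite /coefLP /lp_mul /= cats0 big_cat !big_map /= -sumrN; congr (_ + _).
  apply: eq_big => [y|y _]; last by rewrite mul1r.
  by rewrite add0r; congr (_ && _); apply/eqP/eqP; lia.
by apply: eq_big => [y|y _]; rewrite ?add0r // mulN1r.
Qed.

Lemma kcoef0 (x y : int) : coefLP lp1 x y = if y == 0 then kcoef 0 x else 0.
Proof.
rewrite /kcoef -[lp_pow _ 0]/lp1 /coefLP !big_cons !big_nil /= andbT (eq_sym 0 y).
by rewrite andbC; case: (y == 0).
Qed.

Definition crossing_sign (c : letter) : int := if c.2 then 1 else -1.

Fixpoint smooth_sign (w : seq letter) (b : bitseq) : int :=
  match w, b with
  | c :: w', f :: b' => (if f then crossing_sign c else 1) * smooth_sign w' b'
  | _, _ => 1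
  end.

Lemma smooth_sign_rcons w b c f : size w = size b ->
  smooth_sign (rcons w c) (rcons b f) =
  smooth_sign w b * (if f then crossing_sign c else 1).
Proof.
elim: w b => [|d w IH] [|g b] //= hs; first by rewrite mulr1 mul1r.
by case: hs => hs; rewrite IH // mulrA.
Qed.

(* With [r] the number of components minus one, the coefficient of [a^x z^y] in
   [sg * z^c * ((a^2 - 1) / z)^r] when every smoothing is first reached at its underpass. *)
Definition weight (l l' : seq nat) pr (sg : int) (c : nat) (x y : int) : int :=
  let r := extra_comps (size l) l l' in
  if precede (travel (size l) l l') pr && (y + r%:Z == c%:Z)
  then sg * kcoef r x else 0.

(** The traversal starts with the last bottom label [z]: a smoothing whose underpass is on [z]
    imposes no condition, while one whose overpass is on [z] annihilates the state
    ([weight_start0]). *)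
Lemma weight_start l z l' pr q t sg c x y : t != z ->
  weight (rcons l z) l' (pr ++ (z, t) :: q) sg c x y =
  weight (rcons l z) l' (pr ++ q) sg c x y.
Proof.
move=> tz; rewrite /weight !precede_cat /precede /= size_rcons /= last_rcons.
by rewrite eqxx (eq_sym z) (negbTE tz).
Qed.

Lemma weight_start0 l z l' pr q t sg c x y :
  weight (rcons l z) l' (pr ++ (t, z) :: q) sg c x y = 0.
Proof.
rewrite /weight !precede_cat /precede /= size_rcons /= last_rcons.
by rewrite eqxx andbF.
Qed.

Lemma weight_scale l l' pr sg a c x y :
  weight l l' pr (a * sg) c.+1 x y = a * weight l l' pr sg c x (y - 1).
Proof.
rewrite /weight; have -> : (y - 1 + (extra_comps (size l) l l')%:Z == c%:Z) =
  (y + (extra_comps (size l) l l')%:Z == c.+1%:Z) by apply/eqP/eqP; lia.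
by case: ifP => _; rewrite ?mulr0 // mulrA.
Qed.

(** A component is finished after one strand, so the exponent of $(a^2-1)/z$ grows by one; [kcoefS]
    then yields the same recurrence as [ncoef_split]. *)
Lemma weight_close l z l' pr sg c x y : size l' = size l -> (0 < size l)%N ->
  z \notin l' -> (forall p, p \in pr -> (p.1 != z) && (p.2 != z)) ->
  weight (rcons l z) (insert_at (size l) z l') pr sg c x y =
  weight l l' pr sg c (x - 2) (y + 1) - weight l l' pr sg c x (y + 1).
Proof.
move=> hl l0 hz hp; rewrite /weight size_rcons travel_insert //.
rewrite extra_comps_insert // eqxx l0 /= precede_cons //.
move: (extra_comps _ _ _) => r; rewrite add1n.
have -> : (y + 1 + r%:Z == c%:Z) = (y + r.+1%:Z == c%:Z) by apply/eqP/eqP; lia.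
by case: ifP => _; rewrite ?subr0 // kcoefS mulrBr.
Qed.

Lemma weight_destab l z s l' pr sg c x y : size l' = size l -> (s < size l)%N ->
  z \notin l' -> (forall p, p \in pr -> (p.1 != z) && (p.2 != z)) ->
  weight (rcons l z) (insert_at s z l') pr sg c x y =
  weight (rcons (delete_at s l) (nth 0%N l s)) l' pr sg c x y.
Proof.
move=> hl hs hz hp; rewrite /weight !size_rcons travel_insert ?(ltnW hs) //.
rewrite extra_comps_insert ?(ltnW hs) // ltn_eqF // andbF add0n precede_cons //.
by rewrite size_delete_at // (ltn_predK hs).
Qed.

(* The sum over the states of the braid word [u ++ overpass m s ++ v] in which
   the overpass, travelled by the strand [z], is not smoothed. *)
Definition state_sum l z u s v (x y : int) :=
  bsum (size u) (fun b => bsum (size v) (fun b' =>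
    let cur := insert_at s z (run l u b) in
    weight (rcons l z) (run cur v b') (meets l u b ++ meets cur v b')
      (smooth_sign u b * smooth_sign v b') (count id b + count id b') x y)).

Lemma state_sum_nil l z u s x y :
  state_sum l z u s [::] x y = bsum (size u) (fun b =>
    weight (rcons l z) (insert_at s z (run l u b)) (meets l u b)
      (smooth_sign u b) (count id b) x y).
Proof. by rewrite /state_sum; apply: eq_bsum => b _ /=; rewrite cats0 mulr1 addn0. Qed.

Lemma state_sum_nil_l l z s v x y :
  state_sum l z [::] s v x y =
  let cur := insert_at s z l in
  bsum (size v) (fun b => weight (rcons l z) (run cur v b) (meets cur v b)
      (smooth_sign v b) (count id b) x y).
Proof. by rewrite /state_sum /=; apply: eq_bsum => b _ /=; rewrite mul1r add0n. Qed.

Section StateSumStep.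
Variables (l : seq nat) (z : nat) (u : seq letter) (s : nat) (v : seq letter).
Variables (x y : int).

Lemma state_sum_move c c' : crossing_sign c = crossing_sign c' ->
  (forall r, size r = size l ->
    [/\ cross c (insert_at s z r) = insert_at s z (cross c' r),
        nth 0%N (insert_at s z r) (under_pos c) = nth 0%N r (under_pos c') &
        nth 0%N (insert_at s z r) (over_pos c) = nth 0%N r (over_pos c')]) ->
  state_sum l z u s (c :: v) x y = state_sum l z (rcons u c') s v x y.
Proof.
move=> hsg h; rewrite /state_sum size_rcons bsum_rcons.
apply: eq_bsum => b hb /=; have := h (run l u b) (size_run _ _ _).
move=> [h1 h2 h3]; congr (_ + _); apply: eq_bsum => b' _ /=;
  rewrite run_rcons // meets_rcons // smooth_sign_rcons //.
  by rewrite h1 cats0 mul1r mulr1 -(cats1 b) count_cat /= !add0n addn0.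
rewrite h2 h3 -hsg -catA -mulrA -(cats1 b) count_cat /= addn0.
by congr weight; lia.
Qed.

(** Smoothing this crossing would let the traversal, still on its first strand, reach it at the
    overpass; that half of the sum vanishes. *)
Lemma state_sum_over c t :
  (forall r, size r = size l ->
    cross c (insert_at s z r) = insert_at t z r /\
    nth 0%N (insert_at s z r) (over_pos c) = z) ->
  state_sum l z u s (c :: v) x y = state_sum l z u t v x y.
Proof.
move=> h; apply: eq_bsum => b hb /=; have := h (run l u b) (size_run _ _ _).
move=> [h1 h2]; rewrite [X in _ + X]bsum_eq0 ?addr0.
  by apply: eq_bsum => b' _; rewrite h1 mul1r.
by move=> b' _; rewrite h2 weight_start0.
Qed.

(** Both choices survive here and become the two terms of the skein relation; the condition at the
    smoothing holds because the starting strand passes under. *)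
Lemma state_sum_under c t : wf_word (size l) u -> z \notin l ->
  (forall r, size r = size l ->
    [/\ cross c (insert_at s z r) = insert_at t z r,
        nth 0%N (insert_at s z r) (under_pos c) = z &
        nth 0%N (insert_at s z r) (over_pos c) \in r]) ->
  state_sum l z u s (c :: v) x y =
  state_sum l z u t v x y + crossing_sign c * state_sum l z u s v x (y - 1).
Proof.
move=> hu hz h; rewrite /state_sum -bsumZ -bsumD.
apply: eq_bsum => b hb /=; have := h (run l u b) (size_run _ _ _).
move=> [h1 h2 h3]; rewrite -bsumZ; congr (_ + _); apply: eq_bsum => b' _.
  by rewrite h1 mul1r.
rewrite h2 weight_start; last first.
  by apply: contra hz => /eqP <-; exact: run_sub h3.
by rewrite mulrCA addnCA add1n -weight_scale.
Qed.

End StateSumStep.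

Section Expansion.
Variable P : nat -> seq letter -> LP.
Hypothesis HP : is_homfly P.

(** Induction on the letters above the overpass. Its base case, the overpass at the top of the word,
    is left as a hypothesis because it comes from the induction on the number of strands. *)
Lemma ncoef_state_sum_step (l : seq nat) (z : nat) :
  z \notin l ->
  (forall u s x y, wf_word (size l) u -> (s <= size l)%N ->
    ncoef P (size l).+1 (u ++ overpass (size l).+1 s) x y =
    state_sum l z u s [::] x y) ->
  forall u s v x y, wf_word (size l) u -> (s <= size l)%N ->
    wf_word (size l).+1 v ->
    ncoef P (size l).+1 (u ++ overpass (size l).+1 s ++ v) x y =
    state_sum l z u s v x y.
Proof.
move=> hz base u s v; set m := (size l).+1 in base *.
elim: v u s => [|[i e] v IH] u s x y hu hs hv; first by rewrite cats0 base.
case/andP: hv => /= hi hv.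
have wo t : wf_word m (overpass m t) by exact: wf_overpass.
have hu' : wf_word m u by exact: wf_widen hu.
have wuov t : wf_word m (u ++ overpass m t ++ v) by rewrite !wf_cat hu' wo.
have sm : (s < m)%N by [].
case: (ltnP i s) => his.
  rewrite (@state_sum_move l z u s v x y _ (i, e)) //; last first.
    move=> r hr; split; first by rewrite cross_insert_far //=; lia.
      by rewrite nth_insert_at ?hr // ifT // /under_pos /=; case: ifP; lia.
    by rewrite nth_insert_at ?hr // ifT // /over_pos /=; case: ifP; lia.
  rewrite -IH //; last by rewrite -cats1 wf_cat hu /wf_word /=; lia.
  rewrite -cats1 -!catA.
  have his' : (0 < i < s)%N by lia.
  have := @ncoef_weq P m u v _ _ x y (weq_overpass_far HP e his' sm).
  rewrite -!catA /=; apply=> //.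
  by rewrite writhe_cat !writhe_cons writhe_nil addr0 addrC.
case: (ltnP s.+1 i) => hsi.
  rewrite (@state_sum_move l z u s v x y _ (i.-1, e)) //; last first.
    move=> r hr; split; first by rewrite cross_insert_shift //=; lia.
      rewrite nth_insert_at ?hr // /under_pos /= ifN; last by case: ifP; lia.
      by rewrite ifN; case: ifP => //; lia.
    rewrite nth_insert_at ?hr // /over_pos /= ifN; last by case: ifP; lia.
    by rewrite ifN; case: ifP => //; lia.
  rewrite -IH //; last by rewrite -cats1 wf_cat hu /wf_word /=; lia.
  rewrite -cats1 -!catA.
  have im : (i < m)%N by lia.
  have := @ncoef_weq P m u v _ _ x y (weq_overpass_braid HP e hsi im).
  rewrite -!catA /=; apply=> //.
  by rewrite writhe_cat !writhe_cons writhe_nil addr0 addrC.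
(* The overpassing strand takes part in the crossing. For [i = s] it enters from the right: a
   negative letter lengthens the overpass, a positive one sends the strand under and is switched by
   the skein relation. *)
have [his'|his'] : i = s \/ i = s.+1 by lia.
  have hs0 : (0 < s < m)%N by lia.
  have hs1 : (0 < s <= size l)%N by lia.
  have over w : ncoef P m (u ++ overpass m s ++ (s, false) :: w) x y =
      ncoef P m (u ++ overpass m s.-1 ++ w) x y.
    by rewrite overpass_left // -cats1 -!catA.
  subst i; case: e.
    rewrite (@state_sum_under l z u s v x y _ s.-1) //; last first.
      move=> r hr; split; first by rewrite cross_insert_left ?hr.
        by rewrite nth_insert_at ?hr // /under_pos /= ltnn eqxx.
      rewrite nth_insert_at ?hr // /over_pos /= ifT; last by lia.
      by rewrite mem_nth // hr; lia.
    rewrite -!IH //; last by lia.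
    rewrite -over [X in _ + X]mul1r.
    have := @ncoef_skein P HP m (u ++ overpass m s) v s x y.
    by rewrite -!catA => <- //; rewrite addrC subrK.
  rewrite (@state_sum_over l z u s v x y _ s.-1) //; last first.
    move=> r hr; split; first by rewrite cross_insert_left ?hr.
    by rewrite nth_insert_at ?hr // /over_pos /= ltnn eqxx.
  by rewrite over IH //; lia.
(* Now the strand enters from the left and the signs exchange roles: a positive letter cancels the
   last letter of the overpass, a negative one is switched. *)
subst i; have hs1 : (s < size l)%N by lia.
have over w : wf_word m w -> ncoef P m (u ++ overpass m s ++ (s.+1, true) :: w) x y =
    ncoef P m (u ++ overpass m s.+1 ++ w) x y.
  move=> hw; have -> : overpass m s = overpass m s.+1 ++ [:: (s.+1, false)].
    by rewrite -[s in LHS]/(s.+1.-1) overpass_left ?cats1 //; lia.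
  have := @ncoef_weq P m (u ++ overpass m s.+1) w _ _ x y (weq_cancel HP false hi).
  rewrite -!catA /=; apply=> //; first by rewrite !writhe_cons /writhe big_nil.
  by rewrite wf_cat hu' wo.
case: e.
  rewrite (@state_sum_over l z u s v x y _ s.+1) //; last first.
    move=> r hr; split; first by rewrite cross_insert_right ?hr.
    by rewrite nth_insert_at ?hr // /over_pos /= ltnn eqxx.
  by rewrite over // IH.
rewrite (@state_sum_under l z u s v x y _ s.+1) //; last first.
  move=> r hr; split; first by rewrite cross_insert_right ?hr.
    by rewrite nth_insert_at ?hr // /under_pos /= ltnn eqxx.
  rewrite nth_insert_at ?hr // /over_pos /= ifN; last by lia.
  by rewrite gtn_eqF // mem_nth // hr.
rewrite -!IH // -over // mulN1r.
have := @ncoef_skein P HP m (u ++ overpass m s) v s.+1 x y.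
rewrite -!catA => <- //; first by rewrite opprB addrC subrK.
Qed.

(* When the overpass returns to the rightmost position its strand splits off.
   Otherwise conjugation and a Markov move remove the rightmost strand, and what
   is left of the overpass starts the strand that continues it. *)
Lemma ncoef_state_sum (l : seq nat) (z : nat) u s v x y :
  uniq (rcons l z) -> wf_word (size l) u -> (s <= size l)%N ->
  wf_word (size l).+1 v ->
  ncoef P (size l).+1 (u ++ overpass (size l).+1 s ++ v) x y =
  state_sum l z u s v x y.
Proof.
move: {2}(size l) (erefl (size l)) => n hn.
elim: n l z hn u s v x y => [|n IH] l z hn u s v x y hlz hu hs hv.
  have l0 : l = [::] by apply/size0nil.
  subst l; apply: ncoef_state_sum_step => //= {hu hs hv} {}u {}s {}x {}y hu hs.
  have -> : u = [::] by case: u hu => // c u /= /andP[]; lia.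
  have -> : s = 0%N by lia.
  rewrite /state_sum /= /ncoef /overpass /=.
  case: HP => _ [_ -> _]; rewrite /weight /=.
  rewrite kcoef0 mulr1 mul1r addr0.
  by rewrite writhe_nil; congr (if _ then kcoef _ _ else _); lia.
move: (hlz); rewrite rcons_uniq => /andP[hz hl].
apply: ncoef_state_sum_step => // {hu hs hv} {}u {}s {}x {}y hu hs.
have hpr b p : p \in meets l u b -> (p.1 != z) && (p.2 != z).
  move=> /(meets_sub hu) /andP[h1 h2].
  by apply/andP; split; apply: contraNneq hz => <-.
have hrun b : z \notin run l u b by apply: contra hz; exact: run_sub.
rewrite state_sum_nil.
move: hs; rewrite leq_eqVlt => /orP[/eqP hs|hs].
  have -> : overpass (size l).+1 s = [::] by rewrite hs (overpass_nil (size l).+1).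
  rewrite cats0; have l0 : (0 < size l)%N by rewrite hn.
  have := @ncoef_split P HP (size l) u x (y + 1) l0 hu; rewrite addrK => ->.
  have [l1 [t lE]] : exists l1 t, l = rcons l1 t.
    by case/lastP: (l) l0 => // l1 t _; exists l1, t.
  have hn1 : size l1 = n by move: hn; rewrite lE size_rcons => -[].
  (* With [s = size l1] the overpass is empty, and the induction hypothesis treats all of [u] as
     still to be read. *)
  have ihl x' y' : ncoef P (size l) u x' y' = bsum (size u) (fun b =>
      weight l (run l u b) (meets l u b) (smooth_sign u b) (count id b) x' y').
    have := IH l1 t hn1 [::] (size l1) u x' y'.
    rewrite -lE hl (overpass_nil (size l1).+1) state_sum_nil_l insert_at_size -lE.
    have -> : (size l1).+1 = size l by rewrite lE size_rcons.
    by apply.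
  rewrite !ihl -[- bsum _ _]mulN1r -bsumZ -bsumD; apply: eq_bsum => b _.
  rewrite hs mulN1r weight_close ?size_run //.
  exact: hpr.
rewrite overpass_widen; last by lia.
rewrite -(cat1s _ (overpass _ _)) catA ncoef_cyc //; last first.
  by rewrite !wf_cat (wf_widen (leqnSn _) hu) (wf_widen (leqnSn _) (wf_overpass _ _)) /wf_word /= andbT; lia.
rewrite cats1 -rcons_cat ncoef_markov //; last by rewrite wf_cat wf_overpass.
  pose l1 := delete_at s l; pose t := nth 0%N l s.
  have hn1 : (size l1).+1 = size l by rewrite size_delete_at // (ltn_predK hs).
  have lE : insert_at s t l1 = l by exact: insert_delete_at.
  have hl1 : uniq (rcons l1 t) by rewrite rcons_uniq -(uniq_insert_at s) lE.
  have := IH l1 t _ [::] s u x y hl1; rewrite state_sum_nil_l lE hn1 /= => -> //.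
  - apply: eq_bsum => b _.
    by rewrite weight_destab ?size_run //; exact: hpr.
  - by lia.
  - by lia.
by lia.
Qed.

End Expansion.
End StateSum.

(** * The order of traversal *)

Lemma index_delete_at (l : seq nat) p z : uniq l -> z \in l -> index z l != p ->
  index z (delete_at p l) = if index z l < p then index z l else (index z l).-1.
Proof.
move=> ul zl; move: (zl); rewrite -index_mem.
move e: (index z l) => q qs qp; rewrite /delete_at index_cat.
have zE : z = nth 0 l q by rewrite -e nth_index.
case: ltnP => h.
  have -> : z \in take p l.
    by rewrite zE -(nth_take 0 h) mem_nth // size_take; case: ifP; lia.
  by rewrite zE -(nth_take 0 h) index_uniq ?take_uniq // size_take; case: ifP; lia.
have pq : p < q by lia.
rewrite ifN; last first.
  apply/negP => /(nthP 0)[k]; rewrite size_take ifT; last by lia.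
  move=> kp; rewrite nth_take // zE => /eqP; rewrite nth_uniq //; lia.
rewrite size_takel; last by lia.
have -> : z = nth 0 (drop p.+1 l) (q - p.+1) by rewrite nth_drop zE; congr nth; lia.
by rewrite index_uniq ?drop_uniq // ?size_drop; lia.
Qed.

Lemma perm_delete_at (l : seq nat) p : p < size l ->
  perm_eq (nth 0 l p :: delete_at p l) l.
Proof.
by move=> hp; rewrite perm_sym -{1}(insert_delete_at 0 hp) perm_insert_at.
Qed.

Lemma sorted_rcons_max (l : seq nat) y : sorted ltn (rcons l y) ->
  forall x, x \in rcons l y -> x <= y.
Proof.
move=> h x; rewrite mem_rcons inE => /orP[/eqP->//|xl].
have := h; rewrite (sorted_pairwise ltn_trans) pairwise_rcons => /andP[/allP h1 _].
exact: ltnW (h1 x xl).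
Qed.

Section TravelOrder.
Variables (m : nat) (f key : nat -> nat) (top : pred nat).
Hypothesis key_inj : forall x y, x < m -> y < m -> key x = key y -> x = y.
Hypothesis key_next : forall x, x < m -> ~~ top (f x) -> key (f x) = (key x).+1.
Hypothesis key_return : forall x, x < m -> top (f x) -> key (f x) <= key x.
Hypothesis key_top : forall (r : seq nat) y, y \in r -> (forall x, x \in r -> x < m) ->
  (forall x, x \in r -> f x \in r) -> (forall x, x \in r -> x <= y) ->
  top y /\ forall x, x \in r -> key y <= key x.

(** Invariant of the peeling: [f] is the successor in the full state, [z'] the one in the shortened
    state. They differ only where [f z] has already been travelled, and such a strand then returns
    to the current start [y], whose key is least among the strands that remain. *)
Lemma travel_sorted n (l : seq nat) (y : nat) (l' : seq nat) :
  size l = n -> (forall z, z \in rcons l y -> z < m) ->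
  uniq (rcons l y) -> perm_eq l' (rcons l y) -> sorted ltn l ->
  (forall z, z \in rcons l y ->
     let z' := nth 0 (rcons l y) (index z l') in
     if f z \in rcons l y then z' = f z else z' = y) ->
  (forall z, z \in rcons l y -> key y <= key z) ->
  [/\ sorted ltn (map key (travel n.+1 (rcons l y) l')),
      travel n.+1 (rcons l y) l' =i rcons l y &
      extra_comps n.+1 (rcons l y) l' = count top l].
Proof.
elim: n l y l' => [|n IH] l y l' hn hm hu hp hs hf hk.
  have -> : l = [::] by apply: size0nil.
  by split.
have yl' : y \in l' by rewrite (perm_mem hp) mem_rcons mem_head.
have ul' : uniq l' by rewrite (perm_uniq hp).
have sl' : size l' = n.+2 by rewrite (perm_size hp) size_rcons hn.
have hpm : index y l' < n.+2 by rewrite -sl' index_mem.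
have [yl ul] : y \notin l /\ uniq l by apply/andP; rewrite -rcons_uniq.
have mem1 z : z \in l -> z \in rcons l y by move=> h; rewrite mem_rcons inE h orbT.
have ym : y < m by apply: hm; rewrite mem_rcons mem_head.
have kl z : z \in l -> key y < key z.
  move=> zl; rewrite ltn_neqAle hk ?mem1 // andbT; apply/eqP => /key_inj h.
  have yz : y = z by apply: h ym (hm z (mem1 z zl)).
  by move: yl; rewrite yz zl.
have idl z : z \in l -> index z l' != index y l'.
  move=> zl; apply: contra yl => /eqP /(f_equal (nth 0 l')).
  by rewrite (nth_index _ yl') nth_index ?(perm_mem hp) ?mem1 // => <-.
pose p := index y l'.
rewrite [travel _ _ _]/= [extra_comps _ _ _]/= last_rcons.
have tk : take n.+1 (rcons l y) = l by rewrite -cats1 take_size_cat.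
rewrite -/(travel n.+1 _ _) -/(extra_comps n.+1 _ _) tk -/p.
have pdl' : perm_eq (y :: delete_at p l') (y :: l).
  rewrite perm_sym -perm_rcons perm_sym -(permPr hp).
  by rewrite -{1}(nth_index 0 yl') perm_delete_at // sl'.
rewrite perm_cons in pdl'.
have step l1 y1 : rcons l1 y1 =i l -> 
   [/\ sorted ltn (map key (travel n.+1 (rcons l1 y1) (delete_at p l'))),
      travel n.+1 (rcons l1 y1) (delete_at p l') =i rcons l1 y1 &
      extra_comps n.+1 (rcons l1 y1) (delete_at p l') = count top l1] ->
   sorted ltn (map key (y :: travel n.+1 (rcons l1 y1) (delete_at p l'))) /\
   (y :: travel n.+1 (rcons l1 y1) (delete_at p l') =i rcons l y).
  move=> e; move: (travel n.+1 _ _) => t [h1 h2 _]; split; last by move=> z; rewrite inE h2 e mem_rcons inE.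
  rewrite [map _ _]/= [sorted _ _]/= (path_sortedE ltn_trans) h1 andbT.
  by apply/allP => k /mapP[z]; rewrite h2 e => zl ->; exact: kl.
have qlt z : z \in rcons l y -> index z l' < n.+2.
  by move=> zl; rewrite -sl' index_mem (perm_mem hp).
have inner z : z \in rcons l y -> index z l' != n.+1 ->
    f z = nth 0 l (index z l') /\ f z \in l.
  move=> zl qn; have qh : index z l' < size l by rewrite hn ltn_neqAle qn -ltnS qlt.
  have := hf z zl; rewrite /= nth_rcons qh; case: ifP => _ h.
    by rewrite -h mem_nth.
  by move: yl; rewrite -h mem_nth.
have outer z : z \in rcons l y -> index z l' = n.+1 -> f z \notin l.
  move=> zl qn; have := hf z zl; rewrite /= nth_rcons qn hn ltnn eqxx.
  by case: ifP => [_ <-//|h _]; apply: contraFN h; exact: mem1.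
(* The component of [y] ends here, so the remaining strands are closed under [f] and [key_top]
   identifies the next start. *)
case: (eqVneq p n.+1) => hpn.
  have [l1 [y1 lE]] : exists l1 y1, l = rcons l1 y1.
    by case/lastP: (l) hn => // l1 y1 _; exists l1, y1.
  have hf1 z : z \in l -> f z \in l /\ nth 0 l (index z (delete_at p l')) = f z.
    move=> zl; have qn : index z l' != n.+1 by rewrite -hpn idl.
    have [h1 h2] := inner z (mem1 z zl) qn; split=> //.
    rewrite index_delete_at ?(perm_mem hp) ?mem1 ?idl // hpn ifT //.
    by rewrite ltn_neqAle qn -ltnS qlt ?mem1.
  have [ty ky] : top y1 /\ forall x, x \in l -> key y1 <= key x.
    apply: key_top => [|x xl|x /hf1[]//|]; first by rewrite lE mem_rcons mem_head.
      by rewrite hm ?mem1.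
    by rewrite lE; apply: sorted_rcons_max; rewrite -lE.
  have IH1 : [/\ sorted ltn (map key (travel n.+1 l (delete_at p l'))),
      travel n.+1 l (delete_at p l') =i l &
      extra_comps n.+1 l (delete_at p l') = count top l1].
    rewrite {1 2 3 4}lE; apply: IH; rewrite -?lE //.
    - by move: hn; rewrite lE size_rcons => -[].
    - by move=> z zl; rewrite hm ?mem1.
    - by move: hs; rewrite lE -cats1 => /cat_sorted2[].
    - by move=> z /hf1[-> ->].
  have := step l1 y1; rewrite -lE => /(_ _ IH1)[]// s1 s2; split=> //.
  by case: IH1 => _ _ ->; rewrite lE -cats1 count_cat /= ty addnC.
(* The component goes on with [f y], whose key is [(key y).+1], hence least among the keys above
   [key y]. *)
have py : y \in rcons l y by rewrite mem_rcons mem_head.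
have pn : p < size l by rewrite hn ltn_neqAle hpn -ltnS qlt.
have [y1E y1l] := inner y py hpn; rewrite -/p in y1E.
have y1m : f y < m by rewrite hm ?mem1.
have pl1 : perm_eq (rcons (delete_at p l) (f y)) l.
  by rewrite perm_rcons y1E perm_delete_at.
have ntop : ~~ top (f y).
  by apply/negP => /(key_return ym); rewrite leqNgt kl.
rewrite -y1E.
have IH1 : [/\ sorted ltn (map key (travel n.+1 (rcons (delete_at p l) (f y)) (delete_at p l'))),
      travel n.+1 (rcons (delete_at p l) (f y)) (delete_at p l') =i rcons (delete_at p l) (f y) &
      extra_comps n.+1 (rcons (delete_at p l) (f y)) (delete_at p l') = count top (delete_at p l)].
  apply: IH.
  - by rewrite size_delete_at // hn.
  - by move=> z; rewrite (perm_mem pl1) => zl; rewrite hm ?mem1.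
  - by rewrite (perm_uniq pl1).
  - by rewrite (permPr pl1).
  - apply: (subseq_sorted ltn_trans _ hs).
    rewrite /delete_at -{3}(cat_take_drop p l) cat_subseq //.
    by rewrite -addn1 addnC -drop_drop drop_subseq.
  - move=> z; rewrite (perm_mem pl1) => zl /=; rewrite (perm_mem pl1).
    have := qlt z (mem1 z zl); have := idl z zl; rewrite -/p => qp qn.
    have sd : size (delete_at p l) = n by rewrite size_delete_at // hn.
    rewrite index_delete_at ?(perm_mem hp) ?mem1 // nth_rcons sd.
    case: (eqVneq (index z l') n.+1) => qn1.
      rewrite (negbTE (outer z (mem1 z zl) qn1)) qn1.
      have -> : n.+1 < p = false by rewrite ltnNge -hn (ltnW pn).
      by rewrite ltnn eqxx.
    have [h1 h2] := inner z (mem1 z zl) qn1; rewrite h2 h1.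
    have -> : (if index z l' < p then index z l' else (index z l').-1) < n.
      by move: qp qn qn1 pn; rewrite hn; clear; case: ifP; lia.
    rewrite -[in RHS](insert_delete_at 0 pn) nth_insert_at; last by rewrite sd -ltnS -hn.
    by case: ltnP => // h; rewrite ifN.
  - move=> z; rewrite (perm_mem pl1) => zl.
    by rewrite key_next //; exact: kl.
have := step (delete_at p l) (f y) (perm_mem pl1) IH1.
move=> [s1 s2]; split=> //.
case: IH1 => _ _ ->; rewrite /= add0n.
have /permP/(_ top) := pl1; rewrite -cats1 count_cat /= (negbTE ntop) => <-.
by rewrite !addn0.
Qed.
End TravelOrder.

(** * Boundary components of a state *)

Definition flags (w : seq letter) (S : {set 'I_(size w)}) : bitseq :=
  [seq t \in S | t <- enum 'I_(size w)].

Lemma size_flags w S : size (@flags w S) = size w.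
Proof. by rewrite size_map size_enum_ord. Qed.

Lemma nth_flags w S (t : 'I_(size w)) : nth false (@flags w S) t = (t \in S).
Proof. by rewrite (nth_map t) ?size_enum_ord // nth_ord_enum. Qed.

Lemma stepK c : involutive (step c).
Proof.
move=> p; rewrite /step; case: (eqVneq p c.1.-1) => [->|h1].
  by rewrite eqxx; case: eqP.
case: (eqVneq p c.1) => [->|h2]; first by rewrite eqxx.
by rewrite (negbTE h1) (negbTE h2).
Qed.

Section State.
Variables (w : seq letter) (m : nat) (S : {set 'I_(size w)}).
Hypotheses (m_gt0 : 0 < m) (ww : wf_word m w).
Local Notation L := (size w).
Local Notation b := (flags S).
Local Notation bnext := (@bnext w S).
Local Notation mark := (pt_mark w).

Lemma inSE x : inS S x = (x < 2 * L) && nth false b x./2.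
Proof.
rewrite /inS; case: ltnP => //= hx; have ht : x./2 < L by lia.
rewrite -[x./2]/(val (Ordinal ht)) nth_flags; apply/exists_inP/idP.
  by move=> [t tS /eqP/val_inj <-].
by move=> h; exists (Ordinal ht).
Qed.

Lemma wf_crossing t : t < L -> 0 < (crossing w t).1 < m.
Proof. by move=> ht; apply: (allP ww); rewrite mem_nth. Qed.

Definition shift t p := if nth false b t then p else step (crossing w t) p.

Lemma shiftK t : involutive (shift t).
Proof. by move=> p; rewrite /shift; case: (nth _ _ _) => //; rewrite stepK. Qed.

Lemma shift_lt t p : t < L -> p < m -> shift t p < m.
Proof. by move=> ht hp; rewrite /shift; case: ifP => // _; rewrite step_lt ?wf_crossing. Qed.

(* [pos q t] is the position at level [t] of the strand starting at [q]
   in the state, and [lab t] is its inverse. *)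
Fixpoint pos q t := if t is t'.+1 then shift t' (pos q t') else q.
Fixpoint lab t p := if t is t'.+1 then lab t' (shift t' p) else p.

Lemma posK t q : lab t (pos q t) = q.
Proof. by elim: t => //= t IH; rewrite shiftK. Qed.

Lemma labK t p : pos (lab t p) t = p.
Proof. by elim: t p => //= t IH p; rewrite IH shiftK. Qed.

Lemma pos_lt q t : q < m -> t <= L -> pos q t < m.
Proof. by move=> hq; elim: t => //= t IH ht; rewrite shift_lt // IH // ltnW. Qed.

Lemma lab_lt t p : p < m -> t <= L -> lab t p < m.
Proof. by elim: t p => //= t IH p hp ht; rewrite IH ?shift_lt // ltnW. Qed.

Lemma run_take t : t <= L ->
  run (iota 0 m) (take t w) (take t b) = mkseq (lab t) m.
Proof.
elim: t => [|t IH] ht; first by rewrite !take0 /= /mkseq map_id.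
rewrite (take_nth (0, true)) // (take_nth false) ?size_flags //.
rewrite run_rcons ?size_take ?size_flags // IH ?(ltnW ht) //.
case: ifP => hf; first by apply: eq_mkseq => p /=; rewrite /shift hf.
apply: (@eq_from_nth _ 0); rewrite ?size_cross !size_mkseq // => p hp.
rewrite nth_mkseq ?size_mkseq // !nth_mkseq ?step_lt ?wf_crossing //.
  by rewrite /= /shift hf.
by rewrite size_mkseq.
Qed.

Lemma meets_take t : t <= L ->
  meets (iota 0 m) (take t w) (take t b) =
  [seq (lab k (under_pos (crossing w k)), lab k (over_pos (crossing w k)))
     | k <- iota 0 t & nth false b k].
Proof.
elim: t => [|t IH] ht; first by rewrite !take0.
rewrite (take_nth (0, true)) // (take_nth false) ?size_flags //.
rewrite meets_rcons ?size_take ?size_flags // IH ?(ltnW ht) // run_take ?(ltnW ht) //.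
rewrite -[in iota _ t.+1]addn1 iotaD filter_cat map_cat /= add0n; case: ifP => //= hf.
have := wf_crossing ht; rewrite -/(crossing w t) => hc.
case/andP: hc => _ hc; have hc' := leq_ltn_trans (leq_pred _) hc.
by rewrite !nth_mkseq // /under_pos /over_pos; case: ifP.
Qed.

Definition point_pos x :=
  let c := crossing w x./2 in
  if is_head_at c c.1.-1 == odd x then c.1.-1 else c.1.

(* The strand of the state leaving the point [x], and the level it is at. *)
Definition owner x :=
  if x < 2 * L then lab x./2 (point_pos x) else x - 2 * L.
Definition level x := if x < 2 * L then x./2.+1 else 0.

Lemma point_pos_lt x : x < 2 * L -> point_pos x < m.
Proof.
move=> hx; have ht : x./2 < L by lia.
have /andP[_ h] := wf_crossing ht; rewrite /point_pos.
by case: ifP => _ //; exact: leq_ltn_trans (leq_pred _) h.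
Qed.

Lemma owner_lt x : x < npts w m -> owner x < m.
Proof.
rewrite /owner /npts => hx; case: (ltnP x (2 * L)) => h; last by rewrite ltn_subLR.
by rewrite lab_lt ?point_pos_lt //; lia.
Qed.

Lemma owner_mark q : owner (mark q) = q.
Proof. by rewrite /owner /pt_mark ltnNge leq_addr /= addKn. Qed.

Lemma level_mark q : level (mark q) = 0.
Proof. by rewrite /level /pt_mark ltnNge leq_addr. Qed.

Lemma level_le x : level x <= L.
Proof. by rewrite /level; case: ifP; lia. Qed.

Lemma head_pred c : 0 < c.1 -> is_head_at c c.1.-1 = ~~ is_head_at c c.1.
Proof. by case: c => i []; rewrite /is_head_at /= eqxx; lia. Qed.

(** At a smoothed crossing [bnext] jumps to the partner, at the other position, and the [step]
    inside [gnext] undoes the exchange; the boundary thus keeps its position, as [shift]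
    prescribes. *)
Lemma bnextE x : x < npts w m ->
  bnext x = walk w (L - level x) (pos (owner x) (level x)) (level x).
Proof.
rewrite /npts /Defs.bnext inSE /level /owner => hx; case: ltnP => h /=; last first.
  by rewrite /gnext ltnNge h subn0.
rewrite labK; have ht : x./2 < L by lia.
have c0 : 0 < (crossing w x./2).1 by case/andP: (wf_crossing ht).
case: ifP => hf; rewrite /shift hf.
  have p1 : partner x < 2 * L by rewrite /partner; case: ifP; lia.
  have p2 : (partner x)./2 = x./2 by rewrite /partner; case: ifP; lia.
  have p3 : odd (partner x) = ~~ odd x.
    by rewrite /partner; case: (x) => //= y; case oy: (odd y); rewrite /= ?oy.
  rewrite /gnext p1 p2 p3; congr walk.
  rewrite /point_pos /step; case: (is_head_at _ _); case: (odd x) => /=;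
    by do !case: ifP => ?; lia.
by rewrite /gnext h.
Qed.

Lemma is_head_under c : is_head_at c (under_pos c) = true.
Proof. by case: c => i []; rewrite /is_head_at /= eqxx. Qed.

Lemma is_head_over c : 0 < c.1 -> is_head_at c (over_pos c) = false.
Proof. by case: c => i []; rewrite /is_head_at /over_pos /=; lia. Qed.

Lemma pt_end_lt t h : t < L -> pt_end t h < 2 * L.
Proof. by rewrite /pt_end; case: h; lia. Qed.

Lemma pt_end_half t h : (pt_end t h)./2 = t.
Proof. by rewrite /pt_end; case: h; lia. Qed.

Lemma pt_end_odd t h : odd (pt_end t h) = h.
Proof. by rewrite /pt_end oddD oddM /=; case: h. Qed.

Lemma point_pos_end t p : t < L -> involved (crossing w t) p ->
  point_pos (pt_end t (is_head_at (crossing w t) p)) = p.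
Proof.
move=> ht; have /andP[c0 _] := wf_crossing ht.
rewrite /point_pos pt_end_half pt_end_odd /involved.
case/orP => /eqP ->; rewrite ?eqxx //.
by rewrite head_pred //; case: (is_head_at _ _).
Qed.

Lemma owner_end t p : t < L -> involved (crossing w t) p ->
  owner (pt_end t (is_head_at (crossing w t) p)) = lab t p.
Proof.
by move=> ht hi; rewrite /owner pt_end_lt // pt_end_half point_pos_end.
Qed.

Lemma owner_under t : t < L ->
  owner (pt_end t true) = lab t (under_pos (crossing w t)).
Proof.
move=> ht; have /andP[c0 _] := wf_crossing ht.
rewrite -owner_end //; first by rewrite is_head_under.
by rewrite /involved /under_pos; case: ifP; rewrite eqxx ?orbT.
Qed.

Lemma owner_over t : t < L ->
  owner (pt_end t false) = lab t (over_pos (crossing w t)).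
Proof.
move=> ht; have /andP[c0 _] := wf_crossing ht.
rewrite -owner_end //; first by rewrite is_head_over.
by rewrite /involved /over_pos; case: ifP; rewrite eqxx ?orbT.
Qed.

Lemma walk_skip z t : t < L -> ~~ involved (crossing w t) (pos z t) ->
  walk w (L - t) (pos z t) t = walk w (L - t.+1) (pos z t.+1) t.+1.
Proof.
move=> ht hi; have -> : L - t = (L - t.+1).+1 by lia.
rewrite /= (negbTE hi); congr walk; rewrite /shift; case: ifP => // _.
by move: hi; rewrite /involved /step negb_or => /andP[/negbTE-> /negbTE->].
Qed.

Lemma walk_hit z t : t < L -> involved (crossing w t) (pos z t) ->
  walk w (L - t) (pos z t) t = pt_end t (is_head_at (crossing w t) (pos z t)).
Proof.
move=> ht hi; have -> : L - t = (L - t.+1).+1 by lia.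
by rewrite /= hi.
Qed.

Lemma walk_owner z t : z < m -> t <= L ->
  let x := walk w (L - t) (pos z t) t in
  x = mark (pos z L) \/ x < 2 * L /\ owner x = z.
Proof.
move=> hz; move e: (L - t) => n; elim: n t e => [|n IH] t e ht.
  by left; have -> : t = L by lia.
have tL : t < L by lia.
rewrite -e; case: (boolP (involved (crossing w t) (pos z t))) => hi.
  by right; rewrite walk_hit // pt_end_lt // owner_end // posK.
rewrite walk_skip //; have -> : L - t.+1 = n by lia.
by apply: IH; lia.
Qed.

Lemma owner_bnext x : x < npts w m ->
  bnext x = mark (pos (owner x) L) \/ bnext x < 2 * L /\ owner (bnext x) = owner x.
Proof.
move=> hx; rewrite bnextE //; apply: walk_owner (level_le x).
exact: owner_lt.
Qed.

Lemma mark_lt q : q < m -> mark q < npts w m.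
Proof. by rewrite /pt_mark /npts ltn_add2l. Qed.

Lemma bnext_lt x : x < npts w m -> bnext x < npts w m.
Proof.
move=> hx; case: (owner_bnext hx) => [->|[h _]].
  by rewrite mark_lt ?pos_lt ?owner_lt.
by rewrite /npts (leq_trans h) // leq_addr.
Qed.

Lemma iter_bnext_lt i x : x < npts w m -> iter i bnext x < npts w m.
Proof. by move=> hx; elim: i => //= i; exact: bnext_lt. Qed.

(** A strand need not have a Gauss point at level [t], so passing this level is expressed by the
    walk that starts there. *)
Lemma iter_bnext_level x t : x < npts w m -> level x <= t <= L ->
  exists i, let y := iter i bnext x in
    bnext y = walk w (L - t) (pos (owner x) t) t.
Proof.
move=> hx; elim: t => [|t IH] /andP[h1 h2].
  by exists 0; rewrite /= bnextE //; have -> : level x = 0 by lia.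
move: h1; rewrite leq_eqVlt => /orP[/eqP h1|h1].
  by exists 0; rewrite /= bnextE // h1.
case: IH => [|i /= hi]; first by lia.
case: (boolP (involved (crossing w t) (pos (owner x) t))) => hv; last first.
  by exists i; rewrite /= hi walk_skip.
exists i.+1; rewrite /= hi walk_hit // bnextE; last first.
  by rewrite /npts (leq_trans (pt_end_lt _ h2)) // leq_addr.
by rewrite owner_end // posK /level pt_end_lt // pt_end_half.
Qed.

(** * Boundary components as cycles of a permutation of the closing strands *)

Definition reach x y := exists i, iter i bnext x = y.

Lemma reach_trans y x z : reach x y -> reach y z -> reach x z.
Proof. by move=> [i <-] [j <-]; exists (j + i); rewrite iterD. Qed.

Lemma reach_mark x : x < npts w m -> reach x (mark (pos (owner x) L)).
Proof.
move=> hx; have [|i /= hi] := @iter_bnext_level x L hx; first by rewrite level_le leqnn.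
by exists i.+1; rewrite /= hi subnn.
Qed.

Lemma reach_owner x : x < npts w m -> reach (mark (owner x)) x.
Proof.
move=> hx; case: (ltnP x (2 * L)) => h; last first.
  by exists 0; rewrite /= /owner ltnNge h /= /pt_mark subnKC.
have hm := mark_lt (owner_lt hx).
have [|i /= hi] := @iter_bnext_level _ x./2 hm; first by rewrite level_mark; lia.
exists i.+1; rewrite /= hi owner_mark /owner h labK.
have ht : x./2 < L by lia.
have /andP[c0 _] := wf_crossing ht.
have hv : involved (crossing w x./2) (point_pos x).
  by rewrite /involved /point_pos; case: ifP; rewrite eqxx ?orbT.
have := @walk_hit (lab x./2 (point_pos x)) _ ht; rewrite labK => -> //.
rewrite /pt_end; suff -> : is_head_at (crossing w x./2) (point_pos x) = odd x.
  by case: (odd x) (odd_double_half x); lia.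
rewrite /point_pos; case: eqP => // /eqP; rewrite head_pred //.
by case: (is_head_at _ _); case: (odd x).
Qed.

(* The permutation of the strand positions whose cycles are the components. *)
Definition next (z : 'I_m) : 'I_m := Ordinal (pos_lt (ltn_ord z) (leqnn L)).

Lemma next_inj : injective next.
Proof.
move=> x y /(congr1 val) /= h; apply: val_inj => /=.
by rewrite -(posK L x) h posK.
Qed.

Definition own x (hx : x < npts w m) : 'I_m := Ordinal (owner_lt hx).

Lemma iter_owner i x (hx : x < npts w m) (hy : iter i bnext x < npts w m) :
  fconnect next (own hx) (own hy).
Proof.
elim: i hy => [|i IH] hy; first by rewrite (_ : own hy = own hx) //; exact: val_inj.
have hi := iter_bnext_lt i hx; apply: connect_trans (IH hi) _.
have /= [h|[_ h]] := owner_bnext hi.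
  rewrite (_ : own hy = next (own hi)) ?fconnect1 //.
  by apply: val_inj; rewrite /= h owner_mark.
by rewrite (_ : own hy = own hi) //; apply: val_inj.
Qed.

Lemma reach_cycle (z z' : 'I_m) : fconnect next z z' -> reach (mark z) (mark z').
Proof.
move=> /iter_findex <-; elim: (findex _ _ _) => [|i IH]; first by exists 0.
apply: reach_trans IH _; have := reach_mark (mark_lt (ltn_ord (iter i next z))).
by rewrite owner_mark.
Qed.

Lemma reachP x y (hx : x < npts w m) (hy : y < npts w m) :
  reach x y <-> fconnect next (own hx) (own hy).
Proof.
split=> [[i e]|h].
  by subst y; exact: iter_owner.
(* [y] may precede [x] on the same strand, so the path first completes the strand of [x] and then
   follows the cycle. *)
apply: (@reach_trans (mark (pos (owner x) L))); first exact: reach_mark.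
apply: reach_trans (reach_owner hy).
by apply: (@reach_cycle (next (own hx)) (own hy)); rewrite -same_fconnect1 //; exact: next_inj.
Qed.

Lemma connP x y (hx : x < npts w m) (hy : y < npts w m) :
  conn m S x y = fconnect next (own hx) (own hy).
Proof.
apply/hasP/idP => [[i _ /eqP e]|].
  by apply/reachP; exists i.
move=> /reachP[i e].
(* [conn] tests fewer than [npts] iterations; on the finite type of points [findex] supplies an
   exponent within this bound. *)
pose bn (p : 'I_(npts w m)) := Ordinal (bnext_lt (ltn_ord p)).
have bnE k p : val (iter k bn p) = iter k bnext (val p).
  by elim: k => //= k ->.
have := fconnect_iter bn i (Ordinal hx).
have -> : iter i bn (Ordinal hx) = Ordinal hy by apply: val_inj; rewrite bnE.
move=> h; exists (findex bn (Ordinal hx) (Ordinal hy)); last first.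
  by rewrite -[x]/(val (Ordinal hx)) -bnE iter_findex.
rewrite mem_iota /= add0n; apply: leq_trans (findex_max h) _.
by have := max_card (fconnect bn (Ordinal hx)); rewrite card_ord.
Qed.

(** * Rightmost closing strands and the order of the strands *)

Definition top (z : 'I_m) : 'I_m := [arg max_(i > z | fconnect next z i) (i : nat)].

Lemma top_connect z : fconnect next z (top z).
Proof. by rewrite /top; case: arg_maxnP => [|i //]; exact: connect0. Qed.

Lemma top_max z i : fconnect next z i -> i <= top z.
Proof. by rewrite /top; case: arg_maxnP => [|k _ h /h //]; exact: connect0. Qed.

Lemma cycle_sym x y : fconnect next x y = fconnect next y x.
Proof. exact: fconnect_sym next_inj _ _. Qed.

Lemma eq_topP x y : reflect (top x = top y) (fconnect next x y).
Proof.
apply: (iffP idP) => [h|h].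
  apply/val_inj/eqP; rewrite eqn_leq; apply/andP; split; apply: top_max.
    by rewrite cycle_sym in h; exact: connect_trans h (top_connect x).
  exact: connect_trans h (top_connect y).
by apply: connect_trans (top_connect x) _; rewrite h cycle_sym top_connect.
Qed.

Lemma topK z : top (top z) = top z.
Proof. by apply/esym/eq_topP/top_connect. Qed.

Definition tops : {set 'I_m} := [set z | top z == z].

Lemma top_in_tops z : top z \in tops.
Proof. by rewrite inE topK. Qed.

(* Strands ordered as the traversal meets them: first by the component, those
   with a larger rightmost position coming first, then along the component. *)
Definition key (z : 'I_m) := (m - top z) * m + findex next (top z) z.

Lemma findex_top_lt z : findex next (top z) z < m.
Proof.
have h : fconnect next (top z) z by rewrite cycle_sym top_connect.
apply: leq_trans (findex_max h) _.
by have := max_card (fconnect next (top z)); rewrite card_ord.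
Qed.

Lemma key_lt z z' : (key z < key z') =
  (top z' < top z) || (top z == top z') && (findex next (top z) z < findex next (top z') z').
Proof.
have [h h'] := (findex_top_lt z, findex_top_lt z').
have [t t'] := (ltn_ord (top z), ltn_ord (top z')).
rewrite /key -(inj_eq val_inj) /=.
move: (findex _ _ _) (findex _ _ _) h h' => i i' h h'.
move: (val (top z)) (val (top z')) t t' => a a' t t'.
by case: (ltngtP a' a) => /= e; last rewrite e ltn_add2l; nia.
Qed.

Lemma key_inj z z' : key z = key z' -> z = z'.
Proof.
move=> h; have := key_lt z z'; have := key_lt z' z; rewrite h !ltnn.
move=> /esym/negbT; rewrite negb_or -leqNgt => /andP[h1 h2].
move=> /esym/negbT; rewrite negb_or -leqNgt => /andP[h3 h4].
have e : top z = top z' by apply/val_inj/eqP; rewrite eqn_leq h1 h3.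
move: h2 h4; rewrite e eqxx /= -!leqNgt => h2 h4.
have {h2 h4} e' : findex next (top z') z = findex next (top z') z'.
  by apply/eqP; rewrite eqn_leq h2 h4.
rewrite -[z](@iter_findex _ next (top z')); last by rewrite cycle_sym -e top_connect.
by rewrite e' iter_findex // cycle_sym top_connect.
Qed.

Lemma key_next z : next z \notin tops -> key (next z) = (key z).+1.
Proof.
move=> hz; have e : top (next z) = top z.
  by apply/esym/eq_topP/fconnect1.
rewrite /key e -addnS; congr (_ + _).
have h : fconnect next (top z) z by rewrite cycle_sym top_connect.
have nE : next z = iter (findex next (top z) z).+1 next (top z).
  by rewrite /= iter_findex.
have := findex_max h; rewrite leq_eqVlt => /orP[/eqP ho|ho].
  move: hz; rewrite nE ho iter_order; last exact: next_inj.
  by rewrite top_in_tops.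
by rewrite [in LHS]nE findex_iter.
Qed.

Lemma key_return z : next z \in tops -> key (next z) <= key z.
Proof.
rewrite inE => /eqP h; have e : top (next z) = top z.
  by apply/esym/eq_topP/fconnect1.
have f0 : findex next (top (next z)) (next z) = 0 by rewrite h findex0.
by rewrite /key f0 e addn0 leq_addr.
Qed.

(** [travel] handles plain numbers, so [key] and [tops] are extended to [nat]; the default values
    concern only numbers that are not strand positions. *)
Definition nkey q := oapp key 0 (insub q).
Definition ntop q := oapp (mem tops) false (insub q).

Lemma nkeyE (z : 'I_m) : nkey z = key z. Proof. by rewrite /nkey valK. Qed.
Lemma ntopE (z : 'I_m) : ntop z = (z \in tops). Proof. by rewrite /ntop valK. Qed.

Lemma iota_pred : rcons (iota 0 m.-1) m.-1 = iota 0 m.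
Proof. by rewrite -{3}(prednK m_gt0) -addn1 iotaD cats1. Qed.

Lemma travel_state : let l' := mkseq (lab L) m in
  [/\ sorted ltn (map nkey (travel m (iota 0 m) l')),
      travel m (iota 0 m) l' =i iota 0 m &
      extra_comps m (iota 0 m) l' = count ntop (iota 0 m.-1)].
Proof.
move=> l'; have lm z : (z \in iota 0 m) = (z < m) by rewrite mem_iota.
have ul' : uniq l'.
  rewrite map_inj_in_uniq ?iota_uniq // => x y _ _ /(f_equal (fun q => pos q L)).
  by rewrite !labK.
have fl z : z < m -> pos z L < m by move=> hz; rewrite pos_lt.
have il z : z < m -> index z l' = pos z L.
  move=> hz; rewrite -{1}(posK L z) -[lab L _](nth_mkseq 0 (lab L) (fl z hz)).
  by rewrite index_uniq // size_mkseq fl.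
have := @travel_sorted m (fun q => pos q L) nkey ntop _ _ _ _ m.-1 (iota 0 m.-1) m.-1 l'.
have max_top (r : seq nat) y : y \in r -> (forall x, x \in r -> x < m) ->
    (forall x, x \in r -> pos x L \in r) -> (forall x, x \in r -> x <= y) ->
    ntop y /\ forall x, x \in r -> nkey y <= nkey x.
  move=> yr rm rc ry.
  have itr (z : 'I_m) i : val z \in r -> val (iter i next z) \in r.
    by move=> zr; elim: i => //= i /rc.
  have topr (z : 'I_m) : val z \in r -> val (top z) \in r.
    by move=> zr; rewrite -(iter_findex (top_connect z)) itr.
  pose y' := Ordinal (rm y yr); have y'r : val y' \in r by [].
  have ty : top y' = y'.
    by apply/val_inj/eqP; rewrite eqn_leq ry ?topr // (top_max (connect0 _ y')).
  split; first by rewrite -[y]/(val y') ntopE inE ty.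
  move=> x xr; rewrite -[y]/(val y') -[x]/(val (Ordinal (rm x xr))) !nkeyE.
  rewrite /key ty findex0 addn0; apply: leq_trans (leq_addr _ _).
  by rewrite leq_mul2r leq_sub2l ?orbT // ry // topr.
rewrite iota_pred (prednK m_gt0); apply=> //.
- move=> x y hx hy; rewrite -[x]/(val (Ordinal hx)) -[y]/(val (Ordinal hy)) !nkeyE.
  by move=> /key_inj ->.
- move=> x hx; rewrite -[x]/(val (Ordinal hx)).
  rewrite -[pos _ _]/(val (next (Ordinal hx))) !nkeyE ntopE; exact: key_next.
- move=> x hx; rewrite -[x]/(val (Ordinal hx)).
  rewrite -[pos _ _]/(val (next (Ordinal hx))) !nkeyE ntopE; exact: key_return.
- by rewrite size_iota.
- by move=> z; rewrite lm.
- exact: iota_uniq.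
- apply: uniq_perm => //; first exact: iota_uniq.
  move=> z; rewrite lm; apply/mapP/idP => [[q]|hz].
    by rewrite lm => hq ->; rewrite lab_lt.
  by exists (pos z L); rewrite ?lm ?fl ?posK.
- exact: iota_ltn_sorted.
- move=> z; rewrite lm => hz /=; rewrite lm fl // il // nth_iota ?fl //.
- move=> z hz; have [|x|x|x|_ h] := max_top (iota 0 m) m.-1; rewrite ?lm ?prednK //.
  + exact: fl.
  + by lia.
  exact: h.
Qed.

Lemma index_travel x y : x < m -> y < m -> x != y ->
  let o := travel m (iota 0 m) (mkseq (lab L) m) in
  (index x o < index y o) = (nkey x < nkey y).
Proof.
move=> hx hy xy o; have [ho om _] := travel_state; rewrite -/o in ho om.
have xo : x \in o by rewrite om mem_iota.
have yo : y \in o by rewrite om mem_iota.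
rewrite sorted_map in ho.
have tr : transitive (relpre nkey ltn) by move=> a b c; exact: ltn_trans.
have hlt := sorted_ltn_index tr ho.
case: (ltngtP (index x o) (index y o)) => h.
- by have /= -> := hlt x y xo yo h.
- by have /= := hlt y x yo xo h; case: ltngtP.
- by move: xy; rewrite -(nth_index 0 xo) h nth_index ?eqxx.
Qed.

Lemma labs_distinct t : t < L ->
  lab t (under_pos (crossing w t)) != lab t (over_pos (crossing w t)).
Proof.
move=> ht; have /andP[c0 _] := wf_crossing ht.
apply/eqP => /(f_equal (fun q => pos q t)); rewrite !labK.
by rewrite /under_pos /over_pos; case: ifP => _ h; lia.
Qed.

Lemma under_pos_lt t : t < L -> under_pos (crossing w t) < m.
Proof. by move=> ht; have := wf_crossing ht; rewrite /under_pos; case: ifP => _; lia. Qed.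

Lemma over_pos_lt t : t < L -> over_pos (crossing w t) < m.
Proof. by move=> ht; have := wf_crossing ht; rewrite /over_pos; case: ifP => _; lia. Qed.

(* The number of passages through the closing strands. *)
Fixpoint laps x i :=
  if i is i'.+1 then laps x i' + (2 * L <= iter i bnext x) else 0.

Lemma laps_mono x i j : i <= j -> laps x i <= laps x j.
Proof.
by move=> /subnK <-; elim: (j - i) => //= k IH; apply: leq_trans IH (leq_addr _ _).
Qed.

Lemma laps_mark (q : 'I_m) i : 2 * L <= iter i.+1 bnext (mark q) ->
  iter i.+1 bnext (mark q) = mark (pos (owner (iter i bnext (mark q))) L).
Proof.
have := owner_bnext (iter_bnext_lt i (mark_lt (ltn_ord q))).
by move=> [//|[h _]]; rewrite leqNgt /= h.
Qed.

Lemma owner_laps (q : 'I_m) i :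
  owner (iter i bnext (mark q)) = iter (laps (mark q) i) next q.
Proof.
elim: i => [|i IH]; first by rewrite /= owner_mark.
rewrite [laps _ _]/=; case: leqP => h.
  by rewrite addn1 [in RHS]/= -IH laps_mark // owner_mark.
have [e|[_ e]] := owner_bnext (iter_bnext_lt i (mark_lt (ltn_ord q))).
  by move: h; rewrite /= e /pt_mark ltnNge leq_addr.
by rewrite addn0 /= e IH.
Qed.

(** When the lap count first reaches the order of [next] at [q], the traversal is back at [mark q];
    any point seen from then on has been seen earlier. *)
Lemma laps_lt (q : 'I_m) i :
  (forall j, j < i -> iter j bnext (mark q) != iter i bnext (mark q)) ->
  laps (mark q) i < order next q.
Proof.
move=> hi; rewrite ltnNge; apply/negP => ho.
have ex : exists j, order next q <= laps (mark q) j by exists i.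
case: (ex_minnP ex) => j hj jmin; have ji := jmin i ho.
case: j => [|j] in hj jmin ji *.
  by move: hj; rewrite leqNgt order_gt0.
have hj' : laps (mark q) j < order next q.
  by rewrite ltnNge; apply/negP => /jmin; rewrite ltnn.
have e : laps (mark q) j.+1 = order next q.
  apply/eqP; rewrite eqn_leq hj andbT; apply: leq_trans hj'.
  by rewrite [laps _ _]/= -[X in _ <= X]addn1 leq_add2l leq_b1.
have h2 : 2 * L <= iter j.+1 bnext (mark q).
  rewrite leqNgt; apply/negP => h; move: hj'; rewrite -e.
  have -> : laps (mark q) j.+1 =
    laps (mark q) j + (2 * L <= iter j.+1 bnext (mark q)) by [].
  by rewrite [2 * L <= _]leqNgt h addn0 ltnn.
have back : iter j.+1 bnext (mark q) = mark q.
  rewrite laps_mark // -[pos _ L]owner_mark -laps_mark // owner_laps e.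
  by rewrite iter_order //; exact: next_inj.
have /negP[] := hi (i - j.+1) (ltac:(lia)).
by rewrite -{2}(subnK ji) iterD back.
Qed.

(** Relates two clocks: [bindex] counts Gauss points and [findex] counts strands. The lap count
    translates the first into the second and is monotone. *)
Lemma bindexP (q : 'I_m) x (hx : x < npts w m) : conn m S (mark q) x ->
  let i := bindex m S (mark q) x in
  i < npts w m /\ findex next q (own hx) = laps (mark q) i.
Proof.
rewrite /conn has_find size_iota => hi /=.
set i := bindex m S (mark q) x.
have ilt : i < npts w m by exact: hi.
split; first exact: ilt.
have iE : iter i bnext (mark q) = x.
  apply/eqP; have := @nth_find _ 0 (fun i => iter i bnext (mark q) == x) (iota 0 (npts w m)).
  by rewrite nth_iota // has_find size_iota; apply.
have hlt : laps (mark q) i < order next q.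
  apply: laps_lt => j ji; rewrite iE.
  have := @before_find _ 0 (fun i => iter i bnext (mark q) == x) (iota 0 (npts w m)) j ji.
  by rewrite nth_iota ?add0n => [->//|]; apply: ltn_trans ji hi.
rewrite -[RHS](findex_iter hlt); congr findex; apply: val_inj => /=.
by rewrite -owner_laps iE.
Qed.

Lemma connE (z : 'I_m) x (hx : x < npts w m) :
  conn m S (mark z) x = (top z == top (own hx)).
Proof.
rewrite (connP (mark_lt (ltn_ord z)) hx).
have -> : own (mark_lt (ltn_ord z)) = z by apply: val_inj; rewrite /= owner_mark.
by apply/eq_topP/eqP.
Qed.

Lemma conn_mark (z z' : 'I_m) : conn m S (mark z) (mark z') = (top z == top z').
Proof.
rewrite (connE _ (mark_lt (ltn_ord z'))); congr (_ == top _).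
by apply: val_inj; rewrite /= owner_mark.
Qed.

(** * Base points, traversal times and colours *)

Section BaseList.
Variable B : {set 'I_m}.

Lemma mem_base_list (z : 'I_m) : (val z \in base_list B) = (z \in B).
Proof. by rewrite mem_sort mem_map ?mem_enum //; exact: val_inj. Qed.

Lemma size_base_list : size (base_list B) = #|B|.
Proof. by rewrite size_sort size_map cardE. Qed.

Lemma uniq_base_list : uniq (base_list B).
Proof. by rewrite sort_uniq map_inj_uniq ?enum_uniq //; exact: val_inj. Qed.

Lemma sorted_base_list : sorted geq (base_list B).
Proof. by apply: sort_sorted => x y; exact: leq_total. Qed.

Lemma base_listP q : q \in base_list B -> exists2 z : 'I_m, z \in B & q = z.
Proof.
rewrite mem_sort => /mapP[z]; rewrite mem_enum => zB ->.
by exists z.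
Qed.

(** The base list decreases, so its entries above [q] form an initial segment, whose length is what
    [lmax] counts. *)
Lemma lmaxP q i : i < #|B| -> (q < nth 0 (base_list B) i) = (i < lmax (base_list B) q).
Proof.
rewrite -size_base_list /lmax; move: (base_list B) sorted_base_list => s.
have tr : transitive geq by move=> x y z h1 h2; exact: leq_trans h2 h1.
elim: s i => // a s IH i; rewrite /= (path_sortedE tr) => /andP[/allP ha hs].
case: (ltnP q a) => qa; first by case: i => [|i] //= hi; rewrite IH // add1n.
have c0 : count (fun b0 => q < b0) s = 0.
  apply/eqP; rewrite -leqn0 leqNgt -has_count; apply/hasPn => x /ha /= xa.
  by rewrite -leqNgt (leq_trans xa).
rewrite c0 addn0 ltn0; case: i => [_|i hi] /=; first by apply/negbTE; rewrite -leqNgt.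
apply/negbTE; rewrite -leqNgt; apply: leq_trans qa.
by apply: (ha (nth 0 s i)); rewrite mem_nth.
Qed.

Lemma index_base_list (z z' : 'I_m) : z \in B -> z' \in B ->
  z' < z -> index (val z) (base_list B) < index (val z') (base_list B).
Proof.
move=> zB z'B h; have tr : transitive geq by move=> x y t h1 h2; exact: leq_trans h2 h1.
rewrite ltnNge leq_eqVlt; apply/negP => /orP[/eqP|].
  move=> /(f_equal (nth 0 (base_list B))); rewrite !nth_index ?mem_base_list //.
  by move=> e; rewrite e ltnn in h.
move=> /(sorted_ltn_index tr sorted_base_list); rewrite !mem_base_list.
by move=> /(_ z'B zB) /=; rewrite leqNgt h.
Qed.

End BaseList.

Lemma btimeE x (hx : x < npts w m) :
  let z := top (own hx) in
  btime m S (base_list tops) x =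
  index (val z) (base_list tops) * npts w m + bindex m S (mark z) x.
Proof.
move=> z; rewrite /btime.
have -> : find (fun q => conn m S (mark q) x) (base_list tops) =
          index (val z) (base_list tops).
  apply: eq_in_find => q /base_listP[z' z'B ->]; rewrite (connE z' hx) /=.
  by move: z'B; rewrite inE => /eqP ->; rewrite (inj_eq val_inj).
by rewrite nth_index // mem_base_list top_in_tops.
Qed.

(** The factor [npts] in [btime] separates components; within one component, more laps mean more
    steps by [laps_mono]. *)
Lemma btime_lt x y (hx : x < npts w m) (hy : y < npts w m) :
  key (own hx) < key (own hy) ->
  btime m S (base_list tops) x < btime m S (base_list tops) y.
Proof.
have cx : conn m S (mark (top (own hx))) x by rewrite (connE _ hx) topK.
have cy : conn m S (mark (top (own hy))) y by rewrite (connE _ hy) topK.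
have [ix fx] := bindexP hx cx; have [iy fy] := bindexP hy cy.
rewrite key_lt (btimeE hx) (btimeE hy) => /orP[h|/andP[/eqP e]].
  have := index_base_list (top_in_tops (own hx)) (top_in_tops (own hy)) h.
  by move: (index _ _) (index _ _) (bindex _ _ _ _) (bindex _ _ _ _) ix iy => a b i j; nia.
rewrite fx fy -e in iy *; rewrite ltn_add2l => h; rewrite ltnNge; apply/negP.
by move=> /(laps_mono (mark (top (own hx)))); rewrite leqNgt h.
Qed.

(** The two ends of a smoothed crossing lie on different strands, whose keys differ by [key_inj]; so
    comparing times amounts to comparing keys, and keys give the order of [travel]. *)
Lemma ascending_precede :
  ascending m S (base_list tops) =
  precede (travel m (iota 0 m) (mkseq (lab L) m)) (meets (iota 0 m) w b).
Proof.
have := meets_take (leqnn L); rewrite take_size take_oversize ?size_flags // => ->.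
rewrite /precede all_map all_filter.
have main t : t < L -> (btime m S (base_list tops) (pt_end t true) <
     btime m S (base_list tops) (pt_end t false)) =
    (index (lab t (under_pos (crossing w t))) (travel m (iota 0 m) (mkseq (lab L) m)) <
     index (lab t (over_pos (crossing w t))) (travel m (iota 0 m) (mkseq (lab L) m))).
  move=> ht; have hp h : pt_end t h < npts w m.
    by rewrite /npts (leq_trans (pt_end_lt _ ht)) // leq_addr.
  rewrite index_travel ?labs_distinct ?lab_lt ?under_pos_lt ?over_pos_lt ?(ltnW ht) //.
  rewrite -owner_under // -owner_over //.
  rewrite -[owner (pt_end t true)]/(val (own (hp true))).
  rewrite -[owner (pt_end t false)]/(val (own (hp false))) !nkeyE.
  apply/idP/idP; last exact: btime_lt.
  apply: contraTT; rewrite -!leqNgt leq_eqVlt => /orP[/eqP/key_inj e|].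
    have := labs_distinct ht; rewrite -owner_under // -owner_over //.
    by have /= -> := f_equal val e; rewrite eqxx.
  by move=> /btime_lt /ltnW.
apply/forall_inP/allP => [h t|h t tS].
  rewrite mem_iota /= add0n => ht; apply/implyP => tS.
  rewrite /= -main //; apply: (h (Ordinal ht)).
  by rewrite -nth_flags.
rewrite main //; have := h (val t); rewrite mem_iota /= add0n ltn_ord nth_flags tS.
exact.
Qed.

Lemma count_iota N (a : pred nat) : count a (iota 0 N) = #|[set i : 'I_N | a i]|.
Proof.
have -> : iota 0 N = index_iota 0 N by rewrite /index_iota subn0.
by rewrite -sum1_count big_mkord -sum1_card; apply: eq_bigl => i; rewrite inE.
Qed.

Lemma count_ntop : count ntop (iota 0 m) = #|tops|.
Proof. by rewrite count_iota; apply: eq_card => z; rewrite inE ntopE. Qed.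

Lemma last_in_tops (z : 'I_m) : val z = m.-1 -> z \in tops.
Proof.
move=> zE; rewrite inE; apply/eqP/val_inj/eqP; rewrite eqn_leq /= zE.
by rewrite -ltnS (prednK m_gt0) ltn_ord -zE (top_max (connect0 _ z)).
Qed.

Lemma card_tops :
  #|tops| = (extra_comps m (iota 0 m) (mkseq (lab L) m)).+1.
Proof.
have [_ _ ->] := travel_state; rewrite -count_ntop -iota_pred -cats1 count_cat /= addn0.
have hm : m.-1 < m by rewrite prednK.
by rewrite -[X in ntop X]/(val (Ordinal hm)) ntopE last_in_tops // addn1.
Qed.

(** [nbound] represents a component by its least Gauss point, [tops] by its rightmost closing
    strand; taking the top of the owner is a bijection between these representatives. *)
Lemma nbound_tops : nbound m S = #|tops|.
Proof.
rewrite /nbound count_iota; set Mn := [set _ | _].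
have MnP (x : 'I_(npts w m)) : reflect (forall y : 'I_(npts w m), conn m S x y -> x <= y) (x \in Mn).
  rewrite inE; apply: (iffP allP) => h y.
    by apply/implyP/h; rewrite mem_iota ltn_ord.
  by rewrite mem_iota /= add0n => hy; apply/implyP; exact: h (Ordinal hy).
pose g (x : 'I_(npts w m)) := top (own (ltn_ord x)).
have cg (x y : 'I_(npts w m)) : conn m S x y = (g x == g y).
  by rewrite (connP (ltn_ord x) (ltn_ord y)); apply/eq_topP/eqP.
have g_inj : {in Mn &, injective g}.
  move=> x y /MnP hx /MnP hy e; apply/val_inj/eqP.
  by rewrite eqn_leq hx ?hy // cg e.
rewrite -(card_in_imset g_inj); apply: eq_card => z; apply/imsetP/idP.
  by move=> [x _ ->]; exact: top_in_tops.
rewrite inE => /eqP zE; pose x0 := Ordinal (mark_lt (ltn_ord z)).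
have gx0 : g x0 = z.
  by rewrite -[RHS]zE; congr top; apply: val_inj; rewrite /= owner_mark.
have [x /= hx xmin] : exists2 x : 'I_(npts w m), g x = z &
    forall y, g y = z -> x <= y.
  case: (@arg_minnP _ x0 (fun x => g x == z) (fun x => x : nat)) => [|x /eqP hx h].
    by rewrite gx0.
  by exists x => // y /eqP; exact: h.
exists x => //; apply/MnP => y; rewrite cg hx => /eqP/esym; exact: xmin.
Qed.

Lemma multibased_inj (B : {set 'I_m}) : multibased m S (base_list B) ->
  {in B &, injective top}.
Proof.
move=> /andP[_ /forallP h] x y xB yB e; apply/eqP.
have lt z : z \in B -> index (val z) (base_list B) < size (base_list B).
  by rewrite index_mem mem_base_list.
have := h (Ordinal (lt x xB)) => /forallP/(_ (Ordinal (lt y yB))) /=.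
rewrite !nth_index ?mem_base_list // conn_mark e eqxx implybF negbK => /eqP[].
move=> /(f_equal (nth 0 (base_list B))); rewrite !nth_index ?mem_base_list //.
by move=> /val_inj ->.
Qed.

Lemma multibased_tops : multibased m S (base_list tops).
Proof.
apply/andP; split; first by rewrite nbound_tops size_base_list.
apply/forallP => i; apply/forallP => j; apply/implyP => ij.
have [x xt xE] := base_listP (mem_nth 0 (ltn_ord i)).
have [y yt yE] := base_listP (mem_nth 0 (ltn_ord j)).
rewrite xE yE conn_mark; apply: contra ij => /eqP e.
have exy : x = y.
  by move: xt yt; rewrite !inE => /eqP xt /eqP yt; rewrite -xt e yt.
rewrite -(inj_eq val_inj) -(nth_uniq 0 (ltn_ord i) (ltn_ord j) (uniq_base_list _)).
by rewrite xE yE exy.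
Qed.

Section Coloring.
Variables (j : nat) (B : {set 'I_m}) (col : {ffun 'I_m -> 'I_j.+1}).
Hypotheses (hB : #|B| = j) (hok : col_ok B col) (hcol : colored S B col).

Lemma color_base z : z \notin B -> exists2 x : 'I_m, x \in B &
  [/\ val x = nth 0 (base_list B) (col z).-1, z < x, 0 < col z & top x = top z].
Proof.
move=> zB; have /andP[c0 cl] : (0 < col z) && (col z <= lmax (base_list B) z).
  by move/forallP: hok => /(_ z); rewrite (negbTE zB).
have cj : (col z).-1 < #|B| by rewrite hB prednK // -ltnS.
have h := lmaxP z cj; rewrite prednK // cl in h.
have [|x xB xE] := @base_listP B (nth 0 (base_list B) (col z).-1).
  by rewrite mem_nth // size_base_list.
exists x => //; split=> //; first by rewrite -xE.
move/forallP: hcol => /(_ z); rewrite zB /= xE conn_mark => /eqP; exact.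
Qed.

(** A coloured strand lies strictly to the left of a base point of its own component. Hence the
    rightmost strand of a component cannot be coloured and must be based, and a second base point
    there is excluded. *)
Lemma color_tops : multibased m S (base_list B) -> B = tops.
Proof.
move=> /multibased_inj inj; apply/setP => z; rewrite inE; apply/idP/eqP => [zB|zt].
  apply/eqP; case: (boolP (top z \in B)) => [tB|tB].
    by apply/eqP/inj; rewrite ?topK.
  have [x xB [_ zx _ e]] := color_base tB; move: zx; rewrite ltnNge => /negP[].
  apply: top_max; apply/eq_topP; by rewrite e topK.
apply: contraT => zB; have [x xB [_ zx _ e]] := color_base zB.
by move: zx; rewrite ltnNge -{1}zt -e (top_max (connect0 _ x)).
Qed.

Lemma color_unique z : B = tops ->
  val (col z) = if z \in tops then 0 else (index (val (top z)) (base_list tops)).+1.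
Proof.
move=> Bt; case: ifP => zt.
  by apply/eqP; move/forallP: hok => /(_ z); rewrite Bt zt.
have [|x xB [xE _ c0 e]] := @color_base z; first by rewrite Bt zt.
rewrite -[LHS](prednK c0); congr _.+1.
have xt : top x = x by apply/eqP; move: xB; rewrite Bt inE.
rewrite -e xt xE -Bt index_uniq ?uniq_base_list // size_base_list hB.
by rewrite prednK // -ltnS.
Qed.

End Coloring.

Definition tops_color j : {ffun 'I_m -> 'I_j.+1} :=
  [ffun z => if z \in tops then ord0
             else inord (index (val (top z)) (base_list tops)).+1].

Lemma tops_colorE j z : #|tops| = j ->
  val (tops_color j z) =
  if z \in tops then 0 else (index (val (top z)) (base_list tops)).+1.
Proof.
move=> hj; rewrite ffunE; case: ifP => // _; rewrite /= inordK // ltnS -hj.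
by rewrite -size_base_list index_mem mem_base_list top_in_tops.
Qed.

Lemma tops_color_ok j : #|tops| = j ->
  col_ok tops (tops_color j) && colored S tops (tops_color j).
Proof.
move=> hj; have it z : index (val (top z)) (base_list tops) < #|tops|.
  by rewrite -size_base_list index_mem mem_base_list top_in_tops.
have zlt z : z \notin tops -> z < top z.
  move=> zt; rewrite ltn_neqAle (top_max (connect0 _ z)) andbT.
  by apply: contra zt => /eqP/val_inj e; rewrite inE -e.
have nt z : nth 0 (base_list tops) (index (val (top z)) (base_list tops)) = top z.
  by rewrite nth_index // mem_base_list top_in_tops.
rewrite /= in nt; apply/andP; split; apply/forallP => z.
  case: ifP => zt; rewrite (tops_colorE _ hj) zt //=.
  by rewrite -lmaxP ?it // nt zlt ?zt.
apply/implyP => zt; rewrite (tops_colorE _ hj) (negbTE zt) /= nt.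
by rewrite conn_mark topK.
Qed.

Lemma based_sum (F : int) k n j :
  (\sum_(B : {set 'I_m} | [exists i in B, val i == m.-1] && (#|B| == j))
    \sum_(col : {ffun 'I_m -> 'I_j.+1} | col_ok B col)
      (if [&& #|S| + k == n + j, multibased m S (base_list B),
              ascending m S (base_list B) & colored S B col] then F else 0)
  = if [&& #|tops| == j, #|S| + k == n + j & ascending m S (base_list tops)]
    then F else 0)%R.
Proof.
have hm : m.-1 < m by rewrite prednK.
case: (eqVneq #|tops| j) => [hj|hj] /=; last first.
  apply: big1 => B /andP[_ /eqP hB]; apply: big1 => col hok; case: ifP => //.
  move=> /and4P[_ hmb _ hcol]; move: hj.
  by rewrite -(color_tops hB hok hcol hmb) hB eqxx.
(* The base point demanded at [m.-1] is present: the last strand is the rightmost one of its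
   component. *)
rewrite (bigD1 tops) /=; last first.
  rewrite hj eqxx andbT; apply/exists_inP; exists (Ordinal hm) => //.
  by rewrite last_in_tops.
rewrite [X in (_ + X)%R]big1 ?addr0; last first.
  move=> B /andP[/andP[_ /eqP hB] hBt]; apply: big1 => col hok; case: ifP => //.
  move=> /and4P[_ hmb _ hcol]; move: hBt.
  by rewrite (color_tops hB hok hcol hmb) eqxx.
have /andP[ok0 col0] := tops_color_ok hj.
rewrite (bigD1 (tops_color j)) //= col0 multibased_tops andbT.
rewrite [X in (_ + X)%R]big1 ?addr0 // => col /andP[hok hne]; case: ifP => //.
move=> /and4P[_ _ _ hcol]; case/eqP: hne; apply/ffunP => z; apply: val_inj.
by rewrite (tops_colorE _ hj) (color_unique hj hok hcol).
Qed.
End State.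

(** * Comparison of the two sums *)

Section Assembly.
Local Open Scope ring_scope.

(** [derA] reads a list of monomials, while [P m w] is known only through its coefficients; this
    passes from one to the other. *)
Lemma derA_coef (I : seq int) d p n : uniq I -> (forall x, x \in p -> x.1.1 \in I) ->
  derA d p n = \sum_(i <- I) coefLP p i n * ffz i d.
Proof.
move=> uI hI; rewrite /derA /coefLP.
transitivity (\sum_(x <- p | x.1.2 == n) \sum_(i <- I | i == x.1.1) x.2 * ffz i d).
  rewrite big_seq_cond [in RHS]big_seq_cond; apply: eq_bigr => x /andP[xp _].
  by rewrite -big_filter (filter_pred1_uniq uI) ?hI // big_seq1.
rewrite (exchange_big_dep xpredT) //=; apply: eq_bigr => i _.
rewrite mulr_suml; apply: eq_big => [x|x /andP[]//].
by rewrite andbC (eq_sym i).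
Qed.

Definition comp_poly e r := lp_mul [:: ((e, 0), 1)] (lp_pow a2m1 r).

Lemma coefLP_comp_poly e r i : coefLP (comp_poly e r) i 0 = kcoef r (i - e).
Proof.
rewrite /kcoef /comp_poly /coefLP /lp_mul /= cats0 big_map.
apply: eq_big => [y|y _]; last by rewrite mul1r.
by rewrite /= add0r; congr (_ && _); apply/eqP/eqP; lia.
Qed.

(** The Leibniz rule for $(a-1)a^e$ at $a=1$. *)
Lemma ffz_shift e d : ffz (e + 1) d.+1 - ffz e d.+1 = d.+1%:Z * ffz e d.
Proof.
rewrite /ffz big_ord_recl [X in _ - X]big_ord_recr /= subr0.
have -> : \prod_(i < d) (e + 1 - (bump 0 i)%:Z) = \prod_(i < d) (e - i%:Z).
  by apply: eq_bigr => i _; rewrite /bump /=; lia.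
by move: (\prod_(i < d) _) => p; rewrite (mulrC p) -mulrBl; congr (_ * _); lia.
Qed.

Lemma derA_comp_polyS d e r : derA d (comp_poly e r.+1) 0 =
  derA d (comp_poly (e + 2) r) 0 - derA d (comp_poly e r) 0.
Proof.
rewrite /derA /comp_poly /lp_mul /= !cats0 !big_map -/(lp_pow a2m1 r).
rewrite /lp_mul /= cats0 big_cat !big_map /= -sumrN; congr (_ + _).
  by apply: eq_big => [x|x _] /=; rewrite ?add0r // !mul1r addrA.
by apply: eq_big => [x|x _] /=; rewrite ?add0r // !mul1r mulN1r mulNr.
Qed.

Lemma derA_comp_poly_shift d e r :
  derA d.+1 (comp_poly (e + 1) r) 0 - derA d.+1 (comp_poly e r) 0 =
  d.+1%:Z * derA d (comp_poly e r) 0.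
Proof.
rewrite /derA /comp_poly /lp_mul /= !cats0 !big_map -sumrB mulr_sumr.
apply: eq_bigr => x _ /=; rewrite -mulrBr mulrCA -ffz_shift.
by congr (_ * (ffz _ _ - _)); lia.
Qed.

Lemma derA_comp_poly0 d e r : (d < r)%N -> derA d (comp_poly e r) 0 = 0.
Proof.
elim: d e r => [|d IH] e [|r] // hr; rewrite derA_comp_polyS.
  rewrite /derA /comp_poly /lp_mul /= !cats0 !big_map -sumrB.
  by apply: big1 => x _; rewrite /ffz !big_ord0 subrr.
(* From $a^2-1=a(a-1)+(a-1)$: each factor $a-1$ absorbs one derivative. *)
have -> : derA d.+1 (comp_poly (e + 2) r) 0 - derA d.+1 (comp_poly e r) 0 =
  d.+1%:Z * derA d (comp_poly (e + 1) r) 0 + d.+1%:Z * derA d (comp_poly e r) 0.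
  rewrite -2!derA_comp_poly_shift; have -> : e + 2 = e + 1 + 1 by lia.
  by ring.
by rewrite !IH // !mulr0 addr0.
Qed.

(** * States as bit sequences and as sets of crossings *)

Fixpoint bitseqs n : seq bitseq :=
  if n is n'.+1 then map (cons false) (bitseqs n') ++ map (cons true) (bitseqs n')
  else [:: [::]].

Lemma bsum_bitseqs n F : bsum n F = \sum_(b <- bitseqs n) F b.
Proof.
elim: n F => [|n IH] F /=; first by rewrite big_seq1.
by rewrite big_cat !big_map !IH.
Qed.

Lemma mem_bitseqs n b : (b \in bitseqs n) = (size b == n).
Proof.
elim: n b => [|n IH] b /=; first by rewrite inE; case: b.
have inj f : injective (cons f : bitseq -> bitseq) by move=> ? ? [].
rewrite mem_cat; case: b => [|f b] /=.
  by apply/negbTE; rewrite negb_or; apply/andP; split; apply/mapP => -[].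
rewrite eqSS -IH; case: f; rewrite mem_map //.
  by rewrite orbC; case: (b \in _) => //=; apply/mapP => -[? _ []].
by case: (b \in _) => //=; apply/mapP => -[? _ []].
Qed.

Lemma uniq_bitseqs n : uniq (bitseqs n).
Proof.
elim: n => //= n IH.
have inj f : injective (cons f : bitseq -> bitseq) by move=> ? ? [].
rewrite cat_uniq !map_inj_uniq // IH /= andbT.
by apply/hasPn => b /mapP[? _ ->]; apply/mapP => -[? _ []].
Qed.

Lemma flags_inj w : injective (@flags w).
Proof.
move=> S S' e; apply/setP => t.
by rewrite -(nth_flags S) e nth_flags.
Qed.

Lemma bsum_flags w F : bsum (size w) F = \sum_(S : {set 'I_(size w)}) F (flags S).
Proof.
rewrite bsum_bitseqs -(big_map (@flags w) xpredT) -[index_enum _]enumT /=.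
apply: perm_big; apply: uniq_perm; first exact: uniq_bitseqs.
  by rewrite map_inj_uniq ?enum_uniq //; exact: flags_inj.
move=> b; rewrite mem_bitseqs; apply/eqP/mapP => [hb|[S _ ->]]; last exact: size_flags.
exists [set t : 'I_(size w) | nth false b t]; first by rewrite mem_enum.
apply: (@eq_from_nth _ false); first by rewrite size_flags.
by move=> t; rewrite hb => ht; rewrite -[t]/(val (Ordinal ht)) nth_flags inE.
Qed.

Lemma count_flags w (S : {set 'I_(size w)}) : count id (flags S) = #|S|.
Proof. by rewrite count_map -sum1_count big_enum_cond -sum1_card; apply: eq_bigl. Qed.

Lemma smooth_signE w b : size b = size w ->
  smooth_sign w b =
  \prod_(t < size w) (if nth false b t then crossing_sign (crossing w t) else 1).
Proof.
elim: w b => [|c w IH] [|f b] //= => [_|[hb]]; first by rewrite big_ord0.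
by rewrite big_ord_recl IH.
Qed.

Lemma smooth_sign_flags w (S : {set 'I_(size w)}) :
  smooth_sign w (flags S) = arrow_sign S.
Proof.
rewrite smooth_signE ?size_flags // /arrow_sign [RHS]big_mkcond.
by apply: eq_bigr => t _; rewrite nth_flags.
Qed.

Section States.
Variables (w : seq letter) (m : nat).
Hypotheses (m_gt0 : (0 < m)%N) (ww : wf_word m w).

Definition top_labels (S : {set 'I_(size w)}) := mkseq (lab S (size w)) m.
Definition state_ok (S : {set 'I_(size w)}) :=
  precede (travel m (iota 0 m) (top_labels S)) (meets (iota 0 m) w (flags S)).
Definition state_extra (S : {set 'I_(size w)}) :=
  extra_comps m (iota 0 m) (top_labels S).

Lemma A_nkjE n k j : A_nkj w m n k j =
  \sum_(S : {set 'I_(size w)})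
     (if [&& (state_extra S).+1 == j, #|S| + k == n + j & state_ok S]%N
      then arrow_sign S else 0).
Proof.
rewrite /A_nkj.
under eq_bigr => B _ do (under eq_bigr => col _ do rewrite big_mkcond; rewrite exchange_big).
rewrite exchange_big; apply: eq_bigr => S _.
by rewrite (based_sum S m_gt0 ww) (card_tops S m_gt0) (ascending_precede S m_gt0).
Qed.

Lemma coefLP_states P i y : is_homfly P -> coefLP (P m w) i y =
  \sum_(S : {set 'I_(size w)})
     (if state_ok S && (y + (state_extra S)%:Z == #|S|%:Z)
      then arrow_sign S * kcoef (state_extra S) (i - (1 - m%:Z - writhe w)) else 0).
Proof.
move=> HP.
have hsz : (size (iota 0 m.-1)).+1 = m by rewrite size_iota prednK.
(* Initial situation: strands labelled by position, the last one with an empty overpass, and all of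
   [w] still to be read. *)
have := @ncoef_state_sum P HP (iota 0 m.-1) m.-1 [::] m.-1 w
  (i - (1 - m%:Z - writhe w)) y.
rewrite hsz overpass_nil /= size_iota leqnn.
have ins : insert_at m.-1 m.-1 (iota 0 m.-1) = iota 0 m.
  by rewrite -{1}(size_iota 0 m.-1) insert_at_size iota_pred.
rewrite state_sum_nil_l ins (iota_pred m_gt0).
move=> /(_ (iota_uniq 0 m) isT isT ww); rewrite /ncoef /= bsum_flags.
have -> : i - (1 - m%:Z - writhe w) + 1 - m%:Z - writhe w = i by lia.
move=> ->; apply: eq_bigr => S _.
rewrite smooth_sign_flags count_flags /weight size_iota.
have := run_take S ww (leqnn (size w)).
by rewrite take_size take_oversize ?size_flags // => ->.
Qed.

Lemma derA_states P d n : is_homfly P -> derA d (P m w) n =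
  \sum_(S : {set 'I_(size w)})
     (if state_ok S && (n + (state_extra S)%:Z == #|S|%:Z)
      then arrow_sign S * derA d (comp_poly (1 - m%:Z - writhe w) (state_extra S)) 0
      else 0).
Proof.
move=> HP; set e := 1 - _ - _.
(* A common finite range for the exponents of $a$ in [P m w] and in the polynomials of all
   states. *)
pose I := undup ([seq x.1.1 | x <- P m w] ++
  flatten [seq [seq x.1.1 | x <- comp_poly e (state_extra A)]
             | A : {set 'I_(size w)}]).
have uI : uniq I by exact: undup_uniq.
rewrite (derA_coef d n uI); last first.
  move=> x xp; rewrite mem_undup mem_cat; apply/orP; left.
  by apply/mapP; exists x.
under eq_bigr => i _ do rewrite (coefLP_states i n HP) mulr_suml.
rewrite exchange_big; apply: eq_bigr => S _; case: ifP => _; last first.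
  by apply: big1 => i _; rewrite mul0r.
rewrite (derA_coef d 0 uI); last first.
  move=> x xp; rewrite mem_undup mem_cat; apply/orP; right.
  apply/flattenP; exists [seq x.1.1 | x <- comp_poly e (state_extra S)].
    by apply/mapP; exists S; rewrite // mem_enum.
  by apply/mapP; exists x.
rewrite mulr_sumr; apply: eq_bigr => i _.
by rewrite coefLP_comp_poly mulrA.
Qed.

Lemma A_nkE n k : A_nk w m n k.+1 =
  \sum_(S : {set 'I_(size w)})
     (if state_ok S && (n%:Z - k%:Z + (state_extra S)%:Z == #|S|%:Z)
      then arrow_sign S * derA k (comp_poly (1 - m%:Z - writhe w) (state_extra S)) 0
      else 0).
Proof.
rewrite /A_nk; under eq_bigr => j _ do rewrite A_nkjE mulr_sumr.
rewrite exchange_big; apply: eq_bigr => S _.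
set r := state_extra S; set e := 1 - _ - _.
have cE : (n%:Z - k%:Z + r%:Z == #|S|%:Z) = (#|S| + k.+1 == n + r.+1)%N.
  by apply/eqP/eqP; lia.
(* For [k < r] the index [r.+1] lies outside the range of [j], and the derivative on the other side
   is zero; otherwise [j = r.+1] is the only term that remains. *)
rewrite cE; case: (ltnP k r) => hr.
  rewrite derA_comp_poly0 // mulr0 if_same big_nat_cond big1 // => j.
  by move=> /andP[/andP[_ hj] _]; rewrite ifN ?mulr0 // -/r; lia.
rewrite (bigD1_seq r.+1) ?iota_uniq //=; last by rewrite mem_index_iota; lia.
rewrite big1 ?addr0 => [|j hj]; last by rewrite eq_sym (negbTE hj) mulr0.
rewrite eqxx /= andbC; case: ifP => _; last by rewrite mulr0.
by rewrite mulrC.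
Qed.

End States.
End Assembly.

(* For every HOMFLY-PT function P, every braid word w on m >= 1 strands and
   every k >= 0: the coefficient of z^n in P^star_{k+1}(G_m) equals the
   coefficient of z^n in  z^k (d^k P(L)/da^k)|_{a=1}, for all integers n. *)
Theorem theorem5p1 (P : nat -> seq letter -> LP) (HP : is_homfly P)
    (m : nat) (w : seq letter) (k : nat) :
  0 < m -> wf_word m w ->
  forall n : int, Pstar_coef w m k.+1 n = derA k (P m w) (n - Posz k)%R.
Proof.
move=> m_gt0 ww [n|n] /=; rewrite (derA_states m_gt0 ww _ _ HP).
  exact: A_nkE.
(* For a negative power of $z$, the exponent condition with $\#S\ge 0$ forces more than $k$ extra
   components, where the derivative vanishes. *)
apply/esym; apply: big1 => S _; case: ifP => // /andP[_ /eqP h].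
by rewrite derA_comp_poly0 ?mulr0 //; lia.
Qed.
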